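(* Let $m\ge 2$, let $\mu_1,\ldots,\mu_m$ be positive integers, $n=\sum_{i=1}^m\mu_i$, $\mathcal U=\sum_{i=1}^m\mu_i^2$, and $\Upsilon=\frac{n^2-n}{\mathcal U-n}$ (with $\Upsilon=\infty$ if all $\mu_i=1$). There is a threshold $\Upsilon_B$ such that for all integers $k\ge m$ the following holds for all sufficiently large $M$: when $k<\Upsilon_B$, $U_k$ is a local maximum of $\beta_{k,M}$; when $k>\Upsilon_B$, $U_k$ is a local minimum of $\beta_{k,M}$. When $m=2$, $\Upsilon_B$ may be chosen as: $\Upsilon_B=\infty$ if $\mu_1=\mu_2=1$; $\Upsilon_B=2+\delta$ if $\mu_1=\mu_2>1$; $\Upsilon_B=1+\delta$ otherwise, for any $\delta\in(0,1)$. When $m\ge 3$: if $\Upsilon=\infty$ then $\Upsilon_B=\infty$; if $\Upsilon<\frac{\sqrt n+1}{\sqrt n-1}$, one may choose $\Upsilon_B=\Upsilon$; in all other cases one may choose $$\Upsilon_B=\frac{\mathcal U+n^2-2n+\sqrt{(n^2+2n-\mathcal U)^2-4n^3}}{2(\mathcal U-n)},$$ and then $\Upsilon-1\le\Upsilon_B<\Upsilon$.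
   Context: $[k]=\{1,\ldots,k\}$, $\Pi_{[k]}$ is the probability simplex in $\mathbb R^k$, $U_k=(1/k,\ldots,1/k)$. For $\mathbf p\in\Pi_{[k]}$, $k\ge m$, let $\Theta(\mathbf p)$ be the $k\times k$ matrix with entries $\theta_{i,j}=p_i^{\mu_j}$, where $\mu_j:=0$ for $m<j\le k$ and $0^0=1$. The permanent of a $N\times N$ matrix $(x_{i,j})$ is $\sum_\pi\prod_i x_{i,\pi(i)}$ over permutations $\pi$ of $[N]$. For a positive integer $M$, let $\mathcal P_M$ be the set of $M\times M$ permutation matrices, and for $\Lambda=(P^{(i,j)})_{i,j\in[k]}$ a $kM\times kM$ block matrix with each block $P^{(i,j)}\in\mathcal P_M$, let $\Theta\odot\Lambda$ be the $kM\times kM$ block matrix whose $(i,j)$ block is $\theta_{i,j}P^{(i,j)}$. The degree-$M$ lifted permanent is $\mathrm{perm}_{B,M}(\Theta)=\langle\mathrm{perm}(\Theta\odot\Lambda)\rangle^{1/M}$, where $\langle\cdot\rangle$ is the average over all $(M!)^{k^2}$ such $\Lambda$. Define $\beta_{k,M}:\Pi_{[k]}\to\mathbb R_+$ by $\beta_{k,M}(\mathbf p)=\mathrm{perm}_{B,M}(\Theta(\mathbf p))$. Local maximum/minimum are relative to $\Pi_{[k]}$. *)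

(* Defs.v *)
From mathcomp Require Import all_boot all_order all_algebra all_fingroup.
From mathcomp Require Import all_classical all_reals all_analysis.

Set Implicit Arguments.
Unset Strict Implicit.
Unset Printing Implicit Defensive.

Import Order.TTheory GRing.Theory Num.Theory.
Import numFieldNormedType.Exports.

Local Open Scope classical_set_scope.
Local Open Scope ring_scope.

Section Permanent.
Context {R : realType}.

Definition permanent (N : nat) (A : 'M[R]_N) : R :=
  \sum_(s : 'S_N) \prod_(i < N) A i (s i).

(* A block matrix (P^(i,j)) of M x M permutation matrices is encoded by the
   family L of the underlying permutations; since perm_mx is injective, the
   uniform average over such families is the uniform average over the
   (M!)^(k^2) block matrices. *)
Definition lift_mx (k M : nat) (A : 'M[R]_k) (L : {ffun 'I_k * 'I_k -> 'S_M}) :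
    'M[R]_(\sum_(i < k) M) :=
  \mxblock_(i < k, j < k) (A i j *: perm_mx (L (i, j))).

Definition lifted_permanent (k M : nat) (A : 'M[R]_k) : R :=
  ((\sum_(L : {ffun 'I_k * 'I_k -> 'S_M}) permanent (lift_mx A L))
     / #|{ffun 'I_k * 'I_k -> 'S_M}|%:R) `^ (M%:R^-1).

End Permanent.

Section Simplex.
Context {R : realType}.

Definition simplex (k : nat) : set 'rV[R]_k :=
  [set p | (forall i, 0 <= p 0 i) /\ \sum_(i < k) p 0 i = 1].

Definition uniform_vec (k : nat) : 'rV[R]_k := const_mx (k%:R^-1).

Definition local_max_on (T : topologicalType) (A : set T) (f : T -> R) (x : T) :=
  A x /\ \forall y \near within A (nbhs x), f y <= f x.

Definition local_min_on (T : topologicalType) (A : set T) (f : T -> R) (x : T) :=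
  A x /\ \forall y \near within A (nbhs x), f x <= f y.

End Simplex.

Arguments simplex {R} k _.

Section Thresholds.
Context {R : realType}.

(* Indices are 0-based, so column j carries mu_(j+1); the default value 0 of
   nth pads mu with zeros up to length k, and 0 ^+ 0 = 1. *)
Definition Theta (mu : seq nat) (k : nat) (p : 'rV[R]_k) : 'M[R]_k :=
  \matrix_(i < k, j < k) p 0 i ^+ nth 0%N mu j.

Definition beta (mu : seq nat) (k M : nat) (p : 'rV[R]_k) : R :=
  lifted_permanent M (Theta mu p).

Definition sum_mu (mu : seq nat) : nat := (\sum_(x <- mu) x)%N.

Definition sumsq_mu (mu : seq nat) : nat := (\sum_(x <- mu) x ^ 2)%N.

Definition Upsilon (mu : seq nat) : \bar R :=
  let n := (sum_mu mu)%:R in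
  let U := (sumsq_mu mu)%:R in
  if all (pred1 1%N) mu then +oo%E else ((n ^+ 2 - n) / (U - n))%:E.

Definition UpsilonB_sqrt (mu : seq nat) : R :=
  let n := (sum_mu mu)%:R in
  let U := (sumsq_mu mu)%:R in
  (U + n ^+ 2 - 2 * n
     + Num.sqrt ((n ^+ 2 + 2 * n - U) ^+ 2 - 4 * n ^+ 3)) / (2 * (U - n)).

(* How large M has to be may depend on k. *)
Definition is_threshold (mu : seq nat) (Y : \bar R) : Prop :=
  forall k : nat, (size mu <= k)%N -> \forall M \near \oo,
    ((k%:R%:E < Y)%E ->
       local_max_on (simplex k) (beta (k := k) mu M) (uniform_vec k)) /\
    ((Y < k%:R%:E)%E ->
       local_min_on (simplex k) (beta (k := k) mu M) (uniform_vec k)).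

End Thresholds.

(* Main.v *)
(* The lifted permanent, raised to the power M, is up to a constant factor the
   sum over balanced colourings c of the kM rows (each colour used M times) of
   prod_(i,j) (M - g_ij)! times a monomial in p, where g_ij counts the rows of
   block i with colour j.  This sum is a symmetric homogeneous polynomial in p,
   so near U_k it is governed by one scalar Hessian, an affine function of
   Var(g_00) for the probability measure with weights prod (M - g_ij)!.
   Exchanging the colours of two rows gives an exact identity
     E[d_00 (h_00 h_11 - h_01 h_10)] = E[h_01 h_10],
   with h = g (M + 1 - g) and d = g - M/k; expanding h about M/k as
   h_0 + h_1 d - d^2 it reads (k / (k - 1))^2 Var(g_00) h_0 h_1 = h_0^2 up to
   third moments.  Third moments are controlled
   for k >= 3 by a concentration argument: moving one row of a block from a colour
   used A times there to one used B < A times multiplies the total weight by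
   h(A) / h(B + 1), and h(A) - h(B + 1) = (A - B - 1) (M - A - B) >= 0.
   For k = 2 the identity shows instead that Var(g_00) / M is unbounded.
   The sign of the Hessian for large M is then that of
   (U - n) k^2 - (U + n^2 - 2n) k + n^2, and Upsilon_B is its larger root. *)
Require Import Defs.
From mathcomp Require Import all_boot all_order all_algebra all_fingroup.
From mathcomp Require Import all_classical all_reals all_analysis.
From mathcomp Require Import zify ring lra.
Set Implicit Arguments.
Unset Strict Implicit.
Unset Printing Implicit Defensive.
Import Order.TTheory GRing.Theory Num.Theory.
Import numFieldNormedType.Exports.
Local Open Scope ring_scope.

(** * Permutations with prescribed data *)

(** The value lists of [g] and [f] are rearrangements of each other, and [s] is read off from the
    rearrangement. *)
Lemma perm_of_equal_fibers (N k : nat) (f g : 'I_N -> 'I_k) :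
  (forall j, \sum_(x < N) (f x == j) = \sum_(x < N) (g x == j))%N ->
  exists s : 'S_N, forall x, f (s x) = g x.
Proof.
move=> fg.
have /tuple_permP[p Hp] : perm_eq [tuple g x | x < N] [tuple f x | x < N].
  apply/allP => j _ /=; rewrite -!sum1_count !big_map; apply/eqP.
  rewrite -enumT !big_enum_cond /=.
  have E h : (\sum_(x < N | pred1 j (h x)) 1 = \sum_(x < N) (h x == j))%N.
    by rewrite big_mkcond; apply: eq_bigr => x _ /=; case: eqP.
  by rewrite [LHS](E g) [RHS](E f) fg.
move/val_inj: Hp => Hp; exists p => x.
by have := congr1 (fun t => tnth t x) Hp; rewrite !tnth_mktuple => ->.
Qed.

Lemma perm_extending (T : eqType) (M : nat) (s : seq T) (u v : T -> 'I_M) :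
  {in s &, injective u} -> {in s &, injective v} ->
  exists p : 'S_M, {in s, forall x, p (u x) = v x}.
Proof.
elim: s => [|a s IH] uI vI; first by exists 1%g.
have [|p Hp] := IH _ (sub_in2 (fun x xs => mem_behead (s := a :: s) xs) vI).
  exact: (sub_in2 (fun x xs => mem_behead (s := a :: s) xs) uI).
have [as_|as_] := boolP (a \in s).
  by exists p => x; rewrite inE => /predU1P[->|]; exact: Hp.
(* The transposition corrects the value at [u a]; it leaves the earlier constraints alone because
   [u] and [v] are injective on [a :: s]. *)
exists (p * tperm (p (u a)) (v a))%g => x; rewrite inE permM => /predU1P[->|xs].
  by rewrite tpermL.
have xa : x != a by apply: contraNneq as_ => <-.
rewrite -(Hp _ xs) tpermD //.
  apply: contra_neq xa => /perm_inj /esym; apply: uI; rewrite inE ?xs ?eqxx ?orbT //.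
rewrite (Hp _ xs).
by apply: contra_neq xa => /esym; apply: vI; rewrite inE ?xs ?eqxx ?orbT.
Qed.

(** The solutions form one coset: they are the products [q * p0] of a fixed solution [p0] with the
    permutations [q] supported off the image of [u]. *)
Lemma card_perm_extending (T : finType) (M : nat) (A : {pred T}) (u v : T -> 'I_M) :
  {in A &, injective u} -> {in A &, injective v} ->
  #|[pred p : 'S_M | [forall (x | x \in A), p (u x) == v x]]| = (M - #|A|)`!%N.
Proof.
move=> uI vI.
have mA : enum A =i A by move=> x; rewrite mem_enum.
have [||p0 Hp0] := @perm_extending _ M (enum A) u v.
- by move=> x y; rewrite !mA; exact: uI.
- by move=> x y; rewrite !mA; exact: vI.
set B : {set 'I_M} := (~: [set u x | x in A])%SET.
have cB : #|B| = (M - #|A|)%N by rewrite cardsCs finset.setCK card_in_imset // card_ord.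
rewrite -cB -card_perm -[RHS](card_imset _ (mulIg p0)); apply: eq_card => p.
rewrite inE; apply/forall_inP/imsetP.
- move=> Hp; exists (p * p0^-1)%g; last by rewrite mulgKV.
  suff: perm_on B (p * p0^-1)%g by [].
  apply/fintype.subsetP => y; rewrite !inE; apply: contraNN => /imsetP[x xA ->].
  by rewrite permM (eqP (Hp _ xA)) -(Hp0 x) ?mA // permK.
- move=> [q qB] -> x xA; rewrite permM.
  rewrite (out_perm qB) ?Hp0 ?mA //.
  by rewrite !inE negbK; apply/imsetP; exists x.
Qed.

(** * The average over lifts as a sum over balanced colourings *)

(** The counts g_ij of the outline. The map [b] from rows to blocks is kept abstract, so that the
    ensemble is studied apart from the indexing of block matrices. *)
Definition cnt (N k : nat) (b : 'I_N -> 'I_k) (c : {ffun 'I_N -> 'I_k})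
    (i j : 'I_k) : nat :=
  (\sum_(x < N | b x == i) (c x == j))%N.

Definition bal (N k M : nat) (c : {ffun 'I_N -> 'I_k}) : bool :=
  [forall j, (\sum_(x < N) (c x == j))%N == M].

(** The number of lifts in which a fixed permutation inducing the colouring [c] meets no zero of the
    permutation blocks; see [sum_lifts]. *)
Definition wt (N k M : nat) (b : 'I_N -> 'I_k) (c : {ffun 'I_N -> 'I_k}) : nat :=
  (\prod_(i < k) \prod_(j < k) (M - cnt b c i j)`!)%N.

Section Blocks.
Context (k M : nat).
Let N := (\sum_(i < k) M)%N.

Definition blk (x : 'I_N) : 'I_k := @tagnat.sig1 k (fun=> M) x.
Definition off (x : 'I_N) : 'I_M := @tagnat.sig2 k (fun=> M) x.
Definition place (i : 'I_k) (a : 'I_M) : 'I_N := @tagnat.Rank k (fun=> M) i a.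

Lemma placeK x : place (blk x) (off x) = x.
Proof. exact: (@tagnat.sig2K k (fun=> M)). Qed.

Lemma blk_place i a : blk (place i a) = i.
Proof. exact: (@tagnat.Rank1K k (fun=> M)). Qed.

Lemma off_place i a : off (place i a) = a.
Proof. by apply: val_inj; rewrite /off /place tagnat.Rank2K. Qed.

Lemma blk_fiber j : (\sum_(x < N) (blk x == j) = M)%N.
Proof.
rewrite (eq_bigr (fun x => if blk x == j then 1 else 0)%N); last by move=> x _; case: eqP.
rewrite -big_mkcond (reindex_onto (place j) off) /=; last first.
  by move=> x /eqP <-; exact: placeK.
rewrite (eq_bigl predT) ?sum1_card ?card_ord // => a.
by rewrite blk_place off_place !eqxx.
Qed.

Lemma off_inj x y : blk x = blk y -> off x = off y -> x = y.
Proof. by move=> bxy oxy; rewrite -(placeK x) bxy oxy placeK. Qed.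

Lemma lift_mxE (R : realType) (A : 'M[R]_k) L x y :
  lift_mx A L x y = A (blk x) (blk y) * (L (blk x, blk y) (off x) == off y)%:R.
Proof. by rewrite /lift_mx !mxE. Qed.

(** The constraints split over the k^2 blocks: the permutation in block (i, j) is prescribed at as
    many points as there are rows of block i with colour j, and [card_perm_extending] counts its
    completions. *)
Lemma sum_lifts (s : 'S_N) :
  (\sum_(L : {ffun 'I_k * 'I_k -> 'S_M})
     \prod_(x < N) (L (blk x, blk (s x)) (off x) == off (s x)))%N
  = wt M blk [ffun x => blk (s x)].
Proof.
under eq_bigr => L _.
  rewrite (partition_big (fun x => (blk x, blk (s x))) predT) //=.
  under eq_bigr => ij _.
    rewrite (eq_bigr (fun x => (L ij (off x) == off (s x)) : nat)); last first.
      by move=> x /eqP <-.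
    over.
  over.
(* The sum over families of permutations becomes a product, over blocks, of sums over one
   permutation. *)
rewrite -(bigA_distr_bigA
  (fun ij (p : 'S_M) => \prod_(x < N | (blk x, blk (s x)) == ij)
     (p (off x) == off (s x)))%N) /wt pair_big /=.
apply: eq_bigr => -[i j] _ /=.
set A := [pred x | (blk x, blk (s x)) == (i, j)].
transitivity (M - #|A|)`!%N; last first.
  congr (_ - _)`!%N; rewrite -sum1_card /cnt [RHS]big_mkcond [LHS]big_mkcond /=.
  by apply: eq_bigr => x _; rewrite !inE xpair_eqE ffunE; do 2!case: eqP.
rewrite -(@card_perm_extending _ _ A off (off \o s)); first last.
- move=> x y; rewrite !inE !xpair_eqE => /andP[_ /eqP bx] /andP[_ /eqP by_] oxy.
  by apply: (@perm_inj _ s); apply: off_inj; rewrite // bx by_.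
- move=> x y; rewrite !inE !xpair_eqE => /andP[/eqP bx _] /andP[/eqP by_ _].
  by apply: off_inj; rewrite bx by_.
rewrite -sum1_card [RHS]big_mkcond /=; apply: eq_bigr => p _; rewrite inE.
case: ifPn => [/forall_inP Hp|].
  by rewrite big1 // => x xA; rewrite (eqP (Hp x _)) ?eqxx.
rewrite negb_forall_in => /exists_inP[x xA Hx].
by rewrite (bigD1 x) //= (negPf Hx).
Qed.

Lemma bal_blk (s : 'S_N) : bal M [ffun x => blk (s x)].
Proof.
apply/forallP => j; apply/eqP; rewrite -[RHS](blk_fiber j) [RHS](reindex_inj (@perm_inj _ s)).
by apply: eq_bigr => x _; rewrite ffunE.
Qed.

(** Left translation by a permutation [s0] that carries [blk] to [c] maps one fibre onto the other,
    so every balanced colouring arises equally often. *)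
Lemma card_perm_blk (c : {ffun 'I_N -> 'I_k}) : bal M c ->
  #|[pred s : 'S_N | [ffun x => blk (s x)] == c]|
  = #|[pred s : 'S_N | [ffun x => blk (s x)] == [ffun x => blk x]]|.
Proof.
move=> /forallP bc.
have [|s0 Hs0] := @perm_of_equal_fibers N k blk c.
  by move=> j; rewrite blk_fiber (eqP (bc j)).
rewrite -[RHS](card_imset _ (mulgI s0)); apply: eq_card => s; rewrite inE.
apply/eqP/imsetP => [Hs|[t]].
  exists (s0^-1 * s)%g; last by rewrite mulKVg.
  rewrite inE; apply/eqP/ffunP => x; rewrite !ffunE permM.
  by rewrite -[in RHS](permKV s0 x) Hs0 -Hs ffunE.
rewrite inE => /eqP /ffunP Ht ->; apply/ffunP => x; rewrite ffunE permM.
by have := Ht (s0 x); rewrite !ffunE => ->.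
Qed.

Lemma sum_permanent_lift : exists2 K : nat, (0 < K)%N &
  forall (R : realType) (A : 'M[R]_k),
    \sum_(L : {ffun 'I_k * 'I_k -> 'S_M}) permanent (lift_mx A L) =
    K%:R * \sum_(c : {ffun 'I_N -> 'I_k} | bal M c)
              (wt M blk c)%:R * \prod_(x < N) A (blk x) (c x).
Proof.
exists #|[pred s : 'S_N | [ffun x => blk (s x)] == [ffun x => blk x]]|.
  apply/card_gt0P; exists 1%g; rewrite inE; apply/eqP/ffunP => x.
  by rewrite !ffunE perm1.
move=> R A; rewrite exchange_big /=.
under eq_bigr => s _.
  under eq_bigr => L _.
    under eq_bigr => x _ do rewrite lift_mxE.
    rewrite big_split /= -natr_prod.
    over.
  rewrite -mulr_sumr -natr_sum sum_lifts.
  over.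
(* The entries of [A] met by [s] depend only on the column blocks, so permutations are grouped by
   the colouring they induce. *)
rewrite (partition_big (fun s : 'S_N => [ffun x => blk (s x)]) (bal M)) /=; last first.
  by move=> s _; exact: bal_blk.
rewrite mulr_sumr; apply: eq_bigr => c bc; rewrite -(card_perm_blk bc).
rewrite mulr_natl -sumr_const; apply: eq_big => [s|s /eqP <-]; first by rewrite inE.
by rewrite mulrC; congr (_ * _); apply: eq_bigr => x _; rewrite ffunE.
Qed.

End Blocks.

(** * The weighted ensemble of balanced colourings *)

Lemma bigD2 (I : finType) (j l : I) (F : I -> nat) : j != l ->
  (\prod_i F i = F j * (F l * \prod_(i | (i != j) && (i != l)) F i))%N.
Proof. by move=> jl; rewrite (bigD1 j) //= (bigD1 l) // eq_sym. Qed.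

Section Ensemble.
Context (R : realType) (N k M : nat) (b : 'I_N -> 'I_k).
Hypothesis fiber_b : forall i, (\sum_(x < N) (b x == i) = M)%N.
Local Notation conf := {ffun 'I_N -> 'I_k}.
Implicit Types (c : conf) (f g : conf -> R).

Lemma cnt_row c i : (\sum_j cnt b c i j = M)%N.
Proof.
rewrite /cnt exchange_big -[RHS](fiber_b i) [LHS]big_mkcond /=; apply: eq_bigr => x _.
case: eqP => // _; rewrite (bigD1 (c x)) //= eqxx big1 // => j.
by rewrite eq_sym => /negPf->.
Qed.

Lemma cnt_col c j : bal M c -> (\sum_i cnt b c i j = M)%N.
Proof.
move=> /forallP/(_ j)/eqP <-; rewrite /cnt (exchange_big_dep predT) //=.
apply: eq_bigr => x _; rewrite (bigD1 (b x)) //= big1 ?addn0 // => i.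
by move=> /andP[/eqP->]; rewrite eqxx.
Qed.

Lemma cnt_le c i j : (cnt b c i j <= M)%N.
Proof. by rewrite -(cnt_row c i) (bigD1 j) //= leq_addr. Qed.

(** A single recolouring usually destroys balance; two of them compose to a [swap], which preserves
    it. *)
Definition upd c (x : 'I_N) (j : 'I_k) : conf := [ffun z => if z == x then j else c z].

Lemma cnt_upd c x j i l :
  (cnt b (upd c x j) i l + ((b x == i) && (c x == l)) =
   cnt b c i l + ((b x == i) && (j == l)))%N.
Proof.
rewrite /cnt; case: eqP => [bx|bx] /=; last first.
  rewrite !addn0; apply: eq_bigr => z /eqP bz; rewrite ffunE.
  by have [zx|//] := eqVneq z x; case: bx; rewrite -zx.
rewrite (bigD1 x) ?bx ?eqxx //= ffunE eqxx [in RHS](bigD1 x) ?bx ?eqxx //=.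
rewrite (eq_bigr (fun z => c z == l : nat)) => [|z /andP[_ /negPf zx]].
  rewrite [LHS]addnC [LHS]addnA [RHS]addnC [RHS]addnA; congr (_ + _)%N; exact: addnC.
by rewrite ffunE zx.
Qed.

Lemma cnt_gt0 c x : (0 < cnt b c (b x) (c x))%N.
Proof. by rewrite /cnt (bigD1 x) //= eqxx. Qed.

Lemma cnt_lt c x j : c x != j -> (cnt b c (b x) j < M)%N.
Proof.
move=> cxj; rewrite -(cnt_row c (b x)) (bigD1 j) //= (bigD1 (c x)) //=.
by have := cnt_gt0 c x; lia.
Qed.

Lemma wt_gt0 c : (0 < wt M b c)%N.
Proof. by rewrite /wt prodn_gt0 // => i; rewrite prodn_gt0 // => j; rewrite fact_gt0. Qed.

(** Only the factorials of the two cells (b x, c x) and (b x, j) change, each by one factor.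
    Cross-multiplication keeps the ratio in [nat]. *)
Lemma wt_upd c x j : c x != j ->
  (wt M b (upd c x j) * (M - cnt b c (b x) j) =
   wt M b c * (M.+1 - cnt b c (b x) (c x)))%N.
Proof.
move=> cxj; have [pos lt] := (cnt_gt0 c x, cnt_lt cxj).
have le := cnt_le c (b x) (c x).
rewrite /wt (bigD1 (b x)) //= [in RHS](bigD1 (b x)) //=.
set P := (\prod_(i < k | i != b x) _)%N; set Q := (\prod_(i < k | i != b x) _)%N.
have -> : P = Q.
  apply: eq_bigr => i /negPf ix; apply: eq_bigr => l _; congr (_ - _)`!%N.
  by have := cnt_upd c x j i l; rewrite (eq_sym (b x)) ix !addn0.
rewrite !(bigD2 _ cxj); set P' := (\prod_(i | _) _)%N; set Q' := (\prod_(i | _) _)%N.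
have -> : P' = Q'.
  apply: eq_bigr => l /andP[/negPf lx /negPf lj]; congr (_ - _)`!%N.
  have := cnt_upd c x j (b x) l.
  by rewrite eqxx !(eq_sym _ l) lj lx !addn0.
have := cnt_upd c x j (b x) j; rewrite !eqxx (negPf cxj) addn0 => ->.
have := cnt_upd c x j (b x) (c x); rewrite !eqxx eq_sym (negPf cxj) addn0 => e.
have -> : (M - cnt b c (b x) j = (M - (cnt b c (b x) j + 1)).+1)%N by lia.
have -> : (M - cnt b (upd c x j) (b x) (c x) = (M - cnt b c (b x) (c x)).+1)%N by lia.
have -> : (M.+1 - cnt b c (b x) (c x) = (M - cnt b c (b x) (c x)).+1)%N by lia.
by rewrite !factS; ring.
Qed.

Definition swap c (x y : 'I_N) : conf := [ffun z => c (tperm x y z)].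

Lemma swapK x y : involutive (fun c => swap c x y).
Proof. by move=> c; apply/ffunP => z; rewrite !ffunE tpermK. Qed.

Lemma bal_swap c x y : bal M (swap c x y) = bal M c.
Proof.
apply: eq_forallb => j; congr (_ == _); rewrite [RHS](reindex_inj (@perm_inj _ (tperm x y))).
by apply: eq_bigr => z _; rewrite ffunE.
Qed.

Lemma swapE c x y : x != y -> swap c x y = upd (upd c x (c y)) y (c x).
Proof.
move=> xy; apply/ffunP => z; rewrite !ffunE.
case: tpermP => [->|->|/eqP/negPf zx /eqP/negPf zy]; rewrite ?eqxx ?(negPf xy) //.
by rewrite zx zy.
Qed.

Lemma cnt_swap c x y : b x != b y -> c x != c y ->
  cnt b (swap c x y) (b x) (c y) = (cnt b c (b x) (c y)).+1 /\
  cnt b (swap c x y) (b y) (c x) = (cnt b c (b y) (c x)).+1.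
Proof.
move=> bxy cxy; have xy : x != y by apply: contraNneq bxy => ->.
rewrite swapE //; set c1 := upd c x (c y).
have c1y : c1 y = c y by rewrite ffunE; case: ifP.
have := cnt_upd c1 y (c x) (b x) (c y); have := cnt_upd c1 y (c x) (b y) (c x).
have := cnt_upd c x (c y) (b x) (c y); have := cnt_upd c x (c y) (b y) (c x).
have byx : (b y == b x) = false by rewrite eq_sym (negPf bxy).
have cyx : (c y == c x) = false by rewrite eq_sym (negPf cxy).
rewrite -/c1 c1y !eqxx byx cyx (negPf bxy) (negPf cxy) /= !addn0 !addn1.
by move=> -> -> -> ->.
Qed.

(** The two recolourings take place in different blocks, so the first does not affect the counts
    entering the second and the ratios of [wt_upd] multiply. *)
Lemma wt_swap c x y : b x != b y -> c x != c y ->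
  (wt M b (swap c x y) *
    ((M.+1 - cnt b (swap c x y) (b x) (c y)) * (M.+1 - cnt b (swap c x y) (b y) (c x))) =
   wt M b c * ((M.+1 - cnt b c (b x) (c x)) * (M.+1 - cnt b c (b y) (c y))))%N.
Proof.
move=> bxy cxy; have xy : x != y by apply: contraNneq bxy => ->.
have [-> ->] := cnt_swap bxy cxy; rewrite !subSS swapE //; set c1 := upd c x (c y).
have c1y : c1 y = c y by rewrite ffunE; case: ifP.
have /wt_upd : c1 y != c x by rewrite c1y eq_sym.
have := wt_upd cxy; rewrite -/c1 c1y.
have := cnt_upd c x (c y) (b y) (c x); have := cnt_upd c x (c y) (b y) (c y).
by rewrite -/c1 (negPf bxy) !addn0 => -> ->; nia.
Qed.

Lemma sum_pairs (P : pred conf) f i j i' j' :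
  \sum_(c | P c) (cnt b c i j * cnt b c i' j')%N%:R * f c =
  \sum_(x | b x == i) \sum_(y | b y == i')
    \sum_(c | [&& P c, c x == j & c y == j']) f c.
Proof.
transitivity (\sum_(c | P c) \sum_(x | b x == i) \sum_(y | b y == i')
    ((c x == j) && (c y == j'))%:R * f c).
  apply: eq_bigr => c _; rewrite /cnt big_distrl natr_sum mulr_suml /=.
  apply: eq_bigr => x _; rewrite big_distrr natr_sum mulr_suml /=.
  by apply: eq_bigr => y _; rewrite mulnb.
rewrite exchange_big; apply: eq_bigr => x _; rewrite exchange_big; apply: eq_bigr => y _.
rewrite [LHS]big_mkcond [RHS]big_mkcond; apply: eq_bigr => c _ /=.
by case: (P c) => //=; case: (_ && _); rewrite ?mul1r ?mul0r.
Qed.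

(** The h of the outline: n choices of a row with the given colour, times the factor M + 1 - n that
    its recolouring contributes in [wt_upd]. *)
Definition hop (n : nat) : nat := (n * (M.+1 - n))%N.

(* Detailed balance for exchanging the values of c at two positions, one in
   row i and the other in row i'. *)
Lemma exchange_identity (G : nat -> R) i i' j j' : i != i' -> j != j' ->
  \sum_(c | bal M c) (wt M b c)%:R *
     (G (cnt b c i j) * (hop (cnt b c i j))%:R * (hop (cnt b c i' j'))%:R) =
  \sum_(c | bal M c) (wt M b c)%:R *
     (G (cnt b c i j).+1 * (hop (cnt b c i j'))%:R * (hop (cnt b c i' j))%:R).
Proof.
move=> ii jj.
transitivity (\sum_(c | bal M c) (cnt b c i j * cnt b c i' j')%N%:R *
  ((wt M b c)%:R * (G (cnt b c i j) *
     ((M.+1 - cnt b c i j) * (M.+1 - cnt b c i' j'))%N%:R))).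
  by apply: eq_bigr => c _; rewrite /hop !natrM; ring.
transitivity (\sum_(c | bal M c) (cnt b c i j' * cnt b c i' j)%N%:R *
  ((wt M b c)%:R * (G (cnt b c i j).+1 *
     ((M.+1 - cnt b c i j') * (M.+1 - cnt b c i' j))%N%:R))); last first.
  by apply: eq_bigr => c _; rewrite /hop !natrM; ring.
rewrite !sum_pairs; apply: eq_bigr => x /eqP bx; apply: eq_bigr => y /eqP by_.
(* Swapping matches the colourings with values (j, j') at (x, y) with those having (j', j); the
   successor in the argument of [G] is the count after the swap. *)
rewrite (reindex_inj (inv_inj (swapK x y))) /=; apply: eq_big => c.
  by rewrite bal_swap !ffunE tpermL tpermR; congr (_ && _); exact: andbC.
rewrite bal_swap !ffunE tpermL tpermR => /and3P[_ /eqP cy /eqP cx].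
have bxy : b x != b y by rewrite bx by_.
have cxy : c x != c y by rewrite cx cy eq_sym.
have := wt_swap bxy cxy; have [] := cnt_swap bxy cxy.
rewrite bx by_ cx cy => -> _ /(congr1 (fun n => n%:R : R)); rewrite !natrM => H.
by rewrite mulrCA H; ring.
Qed.

(** Since all blocks have M rows, some row permutation [p] induces [s] on blocks; [phi] pulls a
    colouring back along [p] and relabels the colours by the inverse of [t]. *)
Lemma symmetry (s t : 'S_k) : exists2 phi : conf -> conf, injective phi &
  forall c, bal M (phi c) = bal M c /\ forall i j, cnt b (phi c) i j = cnt b c (s i) (t j).
Proof.
have [|p Hp] := @perm_of_equal_fibers N k b (fun x => s (b x)).
  move=> j; rewrite fiber_b -(fiber_b (s^-1 j)%g); apply: eq_bigr => x _.
  by rewrite -(inj_eq (@perm_inj _ s)) permKV.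
exists (fun c => [ffun x => (t^-1)%g (c (p x))]).
  move=> c c' /ffunP e; apply/ffunP => x; have := e ((p^-1)%g x).
  by rewrite !ffunE permKV => /perm_inj.
have tE u j : ((t^-1)%g u == j) = (u == t j).
  by rewrite -(inj_eq (@perm_inj _ t)) permKV.
have S c j : (\sum_(x < N) ([ffun x => (t^-1)%g (c (p x))] x == j) = \sum_(x < N) (c x == t j))%N.
  rewrite [RHS](reindex_inj (@perm_inj _ p)); apply: eq_bigr => x _.
  by rewrite ffunE tE.
move=> c; split=> [|i j].
  apply/forallP/forallP => H j; last by rewrite S.
  by have := H ((t^-1)%g j); rewrite S permKV.
rewrite /cnt [RHS](reindex_inj (@perm_inj _ p)); apply: eq_big => x.
  by rewrite Hp (inj_eq (@perm_inj _ s)).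
by rewrite ffunE tE.
Qed.

(** Expectation for the probability measure on balanced colourings with weights proportional to
    [wt]. *)
Definition EE f : R :=
  (\sum_(c | bal M c) (wt M b c)%:R * f c) / \sum_(c | bal M c) (wt M b c)%:R.

Lemma EE_mass_gt0 : 0 < \sum_(c | bal M c) (wt M b c)%:R :> R.
Proof.
(* Colouring each row by its own block is balanced, so the total weight is not zero. *)
have bb : bal M [ffun x => b x].
  by apply/forallP => j; under eq_bigr => x _ do rewrite ffunE; rewrite fiber_b.
by rewrite (bigD1 _ bb) /= ltr_pwDl ?ltr0n ?wt_gt0 // sumr_ge0.
Qed.

Lemma eq_EE f g : (forall c, bal M c -> f c = g c) -> EE f = EE g.
Proof. by move=> fg; congr (_ / _); apply: eq_bigr => c /fg ->. Qed.

Lemma EED f g : EE (fun c => f c + g c) = EE f + EE g.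
Proof. by rewrite /EE -mulrDl -big_split; congr (_ / _); apply: eq_bigr => c _; rewrite mulrDr. Qed.

Lemma EEZ a f : EE (fun c => a * f c) = a * EE f.
Proof. by rewrite /EE mulrA mulr_sumr; congr (_ / _); apply: eq_bigr => c _; rewrite mulrCA. Qed.

Lemma EEB f g : EE (fun c => f c - g c) = EE f - EE g.
Proof.
rewrite -[- EE g]mulN1r -EEZ -EED; apply: eq_EE => c _; by rewrite mulN1r.
Qed.

Lemma EE_cst a : EE (fun=> a) = a.
Proof. by rewrite /EE -mulr_suml mulrAC divff ?mul1r // gt_eqF ?EE_mass_gt0. Qed.

Lemma EE_sum (I : Type) (r : seq I) (P : pred I) (F : I -> conf -> R) :
  EE (fun c => \sum_(i <- r | P i) F i c) = \sum_(i <- r | P i) EE (F i).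
Proof.
elim: r => [|i r IH].
  by rewrite big_nil -[RHS](EE_cst 0); apply: eq_EE => c _; rewrite big_nil.
rewrite big_cons -IH; case: ifP => Pi; rewrite -?EED; apply: eq_EE => c _;
  by rewrite big_cons Pi.
Qed.

Lemma le_EE f g : (forall c, bal M c -> f c <= g c) -> EE f <= EE g.
Proof.
move=> fg; apply: ler_wpM2r; first by rewrite invr_ge0 ltW ?EE_mass_gt0.
by apply: ler_sum => c bc; apply: ler_wpM2l; [exact: ler0n|exact: fg].
Qed.

Lemma EE_norm f : `|EE f| <= EE (fun c => `|f c|).
Proof.
rewrite ler_norml; apply/andP; split; last by apply: le_EE => c _; exact: ler_norm.
rewrite lerNl -mulN1r -EEZ; apply: le_EE => c _.
by rewrite mulN1r -normrN ler_norm.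
Qed.

(** The weight is a product over all cells, hence invariant under permuting blocks and colours
    independently. This reduces moments to representative cells. *)
Lemma EE_perm (s t : 'S_k) (F : ('I_k -> 'I_k -> nat) -> R) :
  EE (fun c => F (fun i j => cnt b c (s i) (t j))) = EE (fun c => F (cnt b c)).
Proof.
have [phi phiI Hphi] := symmetry s t.
have wphi c : wt M b (phi c) = wt M b c.
  rewrite /wt [RHS](reindex_inj (@perm_inj _ s)); apply: eq_bigr => i _.
  rewrite [RHS](reindex_inj (@perm_inj _ t)); apply: eq_bigr => j _.
  by rewrite (Hphi c).2.
rewrite /EE [in RHS](reindex_inj phiI); congr (_ / _).
apply: eq_big => c; first by rewrite (Hphi c).1.
move=> _; rewrite wphi; congr (_ * F _).
by apply: funext => i; apply: funext => j; rewrite (Hphi c).2.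
Qed.

End Ensemble.

(** * The Hessian at the uniform vector *)

(** The approximation is 1 + e_1 + e_2, written in power sums. The constant depends only on the
    number of factors, hence is uniform over colourings later. *)
Lemma taylor2_prod (R : realType) (n : nat) : exists2 C : R, 0 <= C &
  forall (s : seq R) (t : R), size s = n -> 0 <= t <= 1 -> {in s, forall u, `|u| <= t} ->
  `|\prod_(u <- s) (1 + u) -
     (1 + \sum_(u <- s) u + ((\sum_(u <- s) u) ^+ 2 - \sum_(u <- s) u ^+ 2) / 2)|
  <= C * t ^+ 3.
Proof.
elim: n => [|n [C C0 IH]].
  exists 0 => // s t /size0nil -> /andP[t0 _] _; rewrite !big_nil.
  by rewrite (_ : _ - _ = 0) ?normr0 ?mul0r //; field.
exists (2 * C + n%:R ^+ 2 + n%:R); first by rewrite !addr_ge0 ?mulr_ge0 ?sqr_ge0.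
move=> [|a s] t //= [sn] /[dup] t01 /andP[t0 t1] st; rewrite !big_cons.
have at_ : `|a| <= t by apply: st; rewrite mem_head.
have {}st : {in s, forall u, `|u| <= t} by move=> u us; apply: st; rewrite inE us orbT.
have := IH s t sn t01 st.
have cst x : n%:R * x = \sum_(u <- s) x.
  by rewrite big_const_seq iter_addr_0 count_predT sn mulr_natl.
have p1t : `|\sum_(u <- s) u| <= n%:R * t.
  apply: le_trans (ler_norm_sum _ _ _) _; rewrite cst.
  by rewrite !big_seq; apply: ler_sum => u us; exact: st.
have p2t : `|\sum_(u <- s) u ^+ 2| <= n%:R * t ^+ 2.
  apply: le_trans (ler_norm_sum _ _ _) _; rewrite cst.
  rewrite !big_seq; apply: ler_sum => u us; rewrite normrX.
  by rewrite lerXn2r ?nnegrE ?st.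
move: (\prod_(u <- s) (1 + u)) (\sum_(u <- s) u) (\sum_(u <- s) u ^+ 2) p1t p2t => P p1 p2 p1t p2t.
set D := P - _ => HD.
(* A new factor 1 + a multiplies the old error and creates only one further third-order term, a
   times e_2. *)
rewrite (_ : _ - _ = D * (1 + a) + a * ((p1 ^+ 2 - p2) / 2)); last by rewrite /D; field.
apply: le_trans (ler_normD _ _) _; rewrite !normrM.
have h1 : `|D| * `|1 + a| <= C * t ^+ 3 * 2.
  apply: ler_pM => //; apply: le_trans (ler_normD _ _) _; rewrite normr1; lra.
have h2 : `|p1 ^+ 2 - p2| <= (n%:R ^+ 2 + n%:R) * t ^+ 2.
  apply: le_trans (ler_normB _ _) _; rewrite mulrDl lerD // normrX -exprMn.
  by rewrite lerXn2r ?nnegrE ?mulr_ge0.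
have h3 : `|a| * (`|p1 ^+ 2 - p2| * `|2^-1|) <= t * ((n%:R ^+ 2 + n%:R) * t ^+ 2).
  apply: ler_pM; rewrite ?mulr_ge0 //; apply: le_trans h2.
  by rewrite ler_piMr // ger0_norm ?invf_le1; lra.
apply: le_trans (lerD h1 h3) _; rewrite le_eqVlt; apply/orP; left; apply/eqP; ring.
Qed.

Section Moments.
Context (R : realType) (N k M : nat) (b : 'I_N -> 'I_k).
Hypothesis k_gt1 : (1 < k)%N.
Hypothesis fiber_b : forall i, (\sum_(x < N) (b x == i) = M)%N.
Local Notation conf := {ffun 'I_N -> 'I_k}.
Local Notation E := (@EE R N k M b).
Implicit Types (c : conf).

Definition dev c i j : R := (cnt b c i j)%:R - M%:R / k%:R.

Let k_neq0 : k%:R != 0 :> R. Proof. by rewrite pnatr_eq0; lia. Qed.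
Let k1_neq0 : k%:R - 1 != 0 :> R.
Proof. by rewrite subr_eq0 pnatr_eq1; lia. Qed.

Lemma EE_cell (g : nat -> R) i j i' j' :
  E (fun c => g (cnt b c i j)) = E (fun c => g (cnt b c i' j')).
Proof.
rewrite -(EE_perm fiber_b (tperm i i') (tperm j j') (fun m => g (m i j))).
by apply: eq_EE => c _; rewrite !tpermL.
Qed.

Lemma dev_row c i : \sum_j dev c i j = 0.
Proof.
rewrite sumrB -natr_sum (cnt_row fiber_b) sumr_const card_ord -mulr_natr.
by field.
Qed.

Lemma dev_col c j : bal M c -> \sum_i dev c i j = 0.
Proof.
move=> bc; rewrite sumrB -natr_sum (cnt_col _ _ bc) sumr_const card_ord -mulr_natr.
by field.
Qed.

Lemma EE_dev i j : E (fun c => dev c i j) = 0.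
Proof.
apply: (mulfI k_neq0); rewrite mulr0 -(EE_cst fiber_b 0).
rewrite -(eq_EE _ (fun c _ => dev_row c i)) EE_sum //.
rewrite mulr_natl -[X in _ *+ X]card_ord -sumr_const; apply: eq_bigr => l _.
exact: (EE_cell (fun n => n%:R - M%:R / k%:R)).
Qed.

(** Normalised so that the covariance matrix of the deviations is [kappa] times the tensor product
    of two centring projections. *)
Definition kappa (i j : 'I_k) : R :=
  (k%:R / (k%:R - 1)) ^+ 2 * E (fun c => dev c i j ^+ 2).

(** Rows and columns of deviations sum to zero and, by symmetry, the covariance depends only on
    whether i = i' and j = j'. So the variance of one cell determines all covariances. *)
Lemma covariance i0 j0 i i' j j' :
  E (fun c => dev c i j * dev c i' j') =
  kappa i0 j0 * ((i == i')%:R - k%:R^-1) * ((j == j')%:R - k%:R^-1).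
Proof.
pose P i i' j j' := E (fun c => dev c i j * dev c i' j').
have E0 : E (fun=> 0) = 0 by rewrite EE_cst.
have sumk (F : 'I_k -> R) j1 j2 : j1 != j2 ->
    (forall l, l != j1 -> F l = F j2) -> \sum_l F l = F j1 + (k%:R - 1) * F j2.
  move=> j12 HF; rewrite (bigD1 j1) //=; congr (_ + _).
  rewrite (eq_bigr (fun=> F j2)) // sumr_const cardC1 card_ord -[LHS]mulr_natl.
  by rewrite -subn1 natrB //; lia.
have stepr i1 i2 j1 j2 : j1 != j2 -> (k%:R - 1) * P i1 i2 j1 j2 = - P i1 i2 j1 j1.
  move=> j12; apply/eqP; rewrite -addr_eq0 addrC -(sumk (P i1 i2 j1)) //.
    rewrite /P -EE_sum // -{2}E0; apply/eqP/eq_EE => c _.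
    by rewrite -mulr_sumr dev_row mulr0.
  move=> l lj; rewrite /P.
  rewrite -(EE_perm fiber_b 1%g (tperm l j2)
    (fun m => ((m i1 j1)%:R - M%:R / k%:R) * ((m i2 l)%:R - M%:R / k%:R))).
  by apply: eq_EE => c _; rewrite !perm1 tpermL tpermD // eq_sym.
have stepc i1 i2 j1 : i1 != i2 -> (k%:R - 1) * P i1 i2 j1 j1 = - P i1 i1 j1 j1.
  move=> i12; apply/eqP; rewrite -addr_eq0 addrC -(sumk (fun l => P i1 l j1 j1)) //.
    rewrite /P -EE_sum // -{2}E0; apply/eqP/eq_EE => c bc.
    by rewrite -mulr_sumr dev_col ?mulr0.
  move=> l li; rewrite /P.
  rewrite -(EE_perm fiber_b (tperm l i2) 1%g
    (fun m => ((m i1 j1)%:R - M%:R / k%:R) * ((m l j1)%:R - M%:R / k%:R))).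
  by apply: eq_EE => c _; rewrite !perm1 tpermL tpermD // eq_sym.
have diag : P i i j j = E (fun c => dev c i0 j0 ^+ 2).
  by rewrite -(EE_cell (fun n => (n%:R - M%:R / k%:R) ^+ 2) i j).
rewrite /kappa -diag -/(P i i' j j').
have [<-|ii] := eqVneq i i'; have [<-|jj] := eqVneq j j';
  rewrite /= ?mulr1n ?mulr0n; apply: (mulfI k1_neq0).
- by field; rewrite k_neq0 k1_neq0.
- by rewrite stepr //; field; rewrite k_neq0 k1_neq0.
- by rewrite stepc //; field; rewrite k_neq0 k1_neq0.
- apply: (mulfI k1_neq0); rewrite stepr // mulrN stepc //; field.
  by rewrite k_neq0 k1_neq0.
Qed.

Lemma sum_cells (f : 'I_k -> 'I_k -> R) c :
  \sum_x f (b x) (c x) = \sum_i \sum_j f i j * (cnt b c i j)%:R.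
Proof.
transitivity (\sum_i \sum_(x | b x == i) f i (c x)).
  rewrite (partition_big b predT) //=; apply: eq_bigr => i _.
  by apply: eq_bigr => x /eqP ->.
apply: eq_bigr => i _.
transitivity (\sum_j \sum_(x | b x == i) f i j * (c x == j)%:R).
  rewrite exchange_big; apply: eq_bigr => x _; rewrite (bigD1 (c x)) //= eqxx mulr1.
  by rewrite big1 ?addr0 // => j; rewrite eq_sym => /negPf ->; rewrite mulr0.
by apply: eq_bigr => j _; rewrite /cnt natr_sum mulr_sumr.
Qed.

(** * Second-order expansion along perturbations of sum zero *)

Section Perturbation.
Context (mu : 'I_k -> nat) (i0 j0 : 'I_k).

(* The second-order term of E (gen t) at t = 0 is [hess / 2 * \sum_i t i ^+ 2]. *)
Definition hess : R :=
  kappa i0 j0 * (\sum_j (mu j)%:R ^+ 2 - (\sum_j (mu j)%:R) ^+ 2 / k%:R)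
  - (\sum_j (mu j)%:R) * M%:R / k%:R.

(** [lin] and [sq] are the first two power sums of the list in which t (b x) is repeated mu (c x)
    times for each row x. *)
Definition lin (t : 'I_k -> R) c : R := \sum_x t (b x) * (mu (c x))%:R.
Definition sq (t : 'I_k -> R) c : R := \sum_x t (b x) ^+ 2 * (mu (c x))%:R.

Lemma linE t c : \sum_i t i = 0 -> lin t c = \sum_i \sum_j t i * (mu j)%:R * dev c i j.
Proof.
move=> t0; rewrite /lin (sum_cells (fun i j => t i * (mu j)%:R)).
transitivity (\sum_i \sum_j t i * (mu j)%:R * dev c i j
              + \sum_i t i * \sum_j (mu j)%:R * (M%:R / k%:R)).
  rewrite -big_split; apply: eq_bigr => i _; rewrite mulr_sumr -big_split.
  by apply: eq_bigr => j _; rewrite /dev /=; ring.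
by rewrite -mulr_suml t0 mul0r addr0.
Qed.

Lemma EE_lin t : \sum_i t i = 0 -> E (lin t) = 0.
Proof.
move=> t0; rewrite (eq_EE _ (fun c _ => linE c t0)) EE_sum // big1 // => i _.
by rewrite EE_sum // big1 // => j _; rewrite EEZ EE_dev mulr0.
Qed.

Lemma sum_centered (u : 'I_k -> R) :
  \sum_i \sum_j u i * u j * ((i == j)%:R - k%:R^-1) =
  \sum_i u i ^+ 2 - (\sum_i u i) ^+ 2 / k%:R.
Proof.
rewrite expr2 mulr_suml mulr_suml -sumrB; apply: eq_bigr => i _.
rewrite mulr_sumr mulr_suml.
transitivity (\sum_j u i * u j * (i == j)%:R - \sum_j u i * u j / k%:R).
  by rewrite -sumrB; apply: eq_bigr => j _; rewrite mulrBr.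
congr (_ - _); rewrite (bigD1 i) //= eqxx mulr1 big1 ?addr0 ?expr2 // => j.
by rewrite eq_sym => /negPf ->; rewrite mulr0.
Qed.

Lemma EE_lin2 t : \sum_i t i = 0 ->
  E (fun c => lin t c ^+ 2) =
  kappa i0 j0 * (\sum_j (mu j)%:R ^+ 2 - (\sum_j (mu j)%:R) ^+ 2 / k%:R) *
  \sum_i t i ^+ 2.
Proof.
move=> t0.
transitivity (\sum_i \sum_i' \sum_j \sum_j'
  (t i * (mu j)%:R * (t i' * (mu j')%:R)) * E (fun c => dev c i j * dev c i' j')).
  rewrite (eq_EE _ (g := fun c => \sum_i \sum_i' \sum_j \sum_j'
     (t i * (mu j)%:R * (t i' * (mu j')%:R)) * (dev c i j * dev c i' j'))).
    rewrite EE_sum //; apply: eq_bigr => i _; rewrite EE_sum //; apply: eq_bigr => i' _.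
    rewrite EE_sum //; apply: eq_bigr => j _; rewrite EE_sum //; apply: eq_bigr => j' _.
    by rewrite EEZ.
  move=> c _; rewrite linE // expr2 mulr_suml; apply: eq_bigr => i _.
  rewrite mulr_sumr; apply: eq_bigr => i' _; rewrite mulr_suml; apply: eq_bigr => j _.
  by rewrite mulr_sumr; apply: eq_bigr => j' _; ring.
have -> : \sum_i t i ^+ 2 = \sum_i \sum_i' t i * t i' * ((i == i')%:R - k%:R^-1).
  by rewrite sum_centered t0; ring.
rewrite -(sum_centered (fun j => (mu j)%:R)) mulr_sumr; apply: eq_bigr => i _.
rewrite mulr_sumr; apply: eq_bigr => i' _; rewrite mulr_sumr mulr_suml.
apply: eq_bigr => j _; rewrite mulr_sumr mulr_suml; apply: eq_bigr => j' _.
by rewrite (covariance i0 j0); ring.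
Qed.

Lemma EE_sq t : E (sq t) = (\sum_j (mu j)%:R) * M%:R / k%:R * \sum_i t i ^+ 2.
Proof.
rewrite (eq_EE _ (g := fun c => \sum_i \sum_j
  (t i ^+ 2 * (mu j)%:R * dev c i j + t i ^+ 2 * (mu j)%:R * (M%:R / k%:R)))).
  rewrite EE_sum // mulr_sumr; apply: eq_bigr => i _; rewrite EE_sum //.
  rewrite !mulr_suml; apply: eq_bigr => j _.
  by rewrite EED EEZ EE_dev EE_cst //; ring.
move=> c _; rewrite /sq (sum_cells (fun i j => t i ^+ 2 * (mu j)%:R)).
by apply: eq_bigr => i _; apply: eq_bigr => j _; rewrite /dev; ring.
Qed.

(** The monomial of the colouring [c] at p = (1 + t) / k, rescaled to have value 1 at t = 0. *)
Definition gen (t : 'I_k -> R) c : R := \prod_x (1 + t (b x)) ^+ mu (c x).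

Lemma gen_taylor : exists2 C : R, 0 <= C & forall t (e : R), 0 <= e <= 1 ->
  (forall i, `|t i| <= e) -> forall c, bal M c ->
  `|gen t c - (1 + lin t c + (lin t c ^+ 2 - sq t c) / 2)| <= C * e ^+ 3.
Proof.
have [C C0 HC] := taylor2_prod R (\sum_j M * mu j)%N.
exists C => // t e e01 te c /forallP bc.
(* By balance this list of factors has length M times the sum of the [mu j] for every [c], so one
   constant serves all colourings. *)
pose s := flatten [seq nseq (mu (c x)) (t (b x)) | x <- enum 'I_N].
have sumf (F : R -> R) : \sum_(u <- s) F u = \sum_x F (t (b x)) * (mu (c x))%:R.
  rewrite big_flatten big_map big_enum; apply: eq_bigr => x _.
  by rewrite big_nseq iter_addr_0 mulr_natr.
have := HC s e; rewrite (sumf id) (sumf (fun u => u ^+ 2)) -/(lin t c) -/(sq t c).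
have -> : \prod_(u <- s) (1 + u) = gen t c.
  rewrite big_flatten big_map big_enum; apply: eq_bigr => x _.
  by rewrite big_nseq iter_mulr_1.
apply=> //.
  rewrite size_flatten /shape -map_comp sumnE big_map big_enum /=.
  under eq_bigr => x _ do rewrite size_nseq.
  rewrite (partition_big c predT) //=; apply: eq_bigr => j _.
  rewrite -(eqP (bc j)) big_distrl [LHS]big_mkcond; apply: eq_bigr => x _ /=.
  by case: eqP => [->|]; rewrite ?mul1n.
move=> u /flattenP[r /mapP[x _ ->]]; by rewrite mem_nseq => /andP[_ /eqP->].
Qed.

(** The linear term has mean zero when t sums to zero, so the quadratic term decides as soon as it
    beats the cubic remainder. *)
Lemma local_sign : exists2 r : R, 0 < r & forall t, \sum_i t i = 0 ->
  (forall i, `|t i| <= r) ->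
  (hess < 0 -> E (gen t) <= 1) /\ (0 < hess -> 1 <= E (gen t)).
Proof.
have [C C0 HC] := gen_taylor.
have [h0|hn0] := eqVneq hess 0; first by exists 1 => // t _ _; rewrite h0 ltxx.
(* For Euclidean norm e of t at most [q], the remainder C e^3 is at most |hess| / 2 times e^2, the
   size of the quadratic term. *)
pose q := Num.min 1 (`|hess| / (2 * (C + 1))).
have q0 : 0 < q by rewrite lt_min ltr01 divr_gt0 ?normr_gt0 // mulr_gt0 //; lra.
have kp : 0 < k%:R :> R by rewrite ltr0n; lia.
(* Coordinates bounded by q / k have Euclidean norm at most q. *)
exists (q / k%:R); first by rewrite divr_gt0.
move=> t t0 tr; pose v := \sum_i t i ^+ 2; pose e := Num.sqrt v.
have v0 : 0 <= v by apply: sumr_ge0 => i _; exact: sqr_ge0.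
have e0 : 0 <= e by exact: sqrtr_ge0.
have ev : e ^+ 2 = v by rewrite sqr_sqrtr.
have te i : `|t i| <= e.
  rewrite -(@ler_pXn2r _ 2) ?nnegrE // real_normK ?num_real // ev /v (bigD1 i) //=.
  by rewrite lerDl sumr_ge0 // => l _; exact: sqr_ge0.
have eq : e <= q.
  rewrite -(@ler_pXn2r _ 2) ?nnegrE ?(ltW q0) // ev.
  have : v <= \sum_(i < k) (q / k%:R) ^+ 2.
    apply: ler_sum => i _; rewrite -(@real_normK _ (t i)) ?num_real //.
    by rewrite lerXn2r ?nnegrE ?(le_trans _ (tr i)).
  have -> : \sum_(i < k) (q / k%:R) ^+ 2 = q ^+ 2 / k%:R.
    by rewrite sumr_const card_ord -[LHS]mulr_natl; field.
  move=> /le_trans; apply.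
  by rewrite ler_pdivrMr // ler_peMr ?sqr_ge0 // ler1n; lia.
have e1 : e <= 1 by apply: le_trans eq _; rewrite ge_min lexx.
have eh : (C + 1) * e <= `|hess| / 2.
  have := le_trans eq (_ : _ <= `|hess| / (2 * (C + 1))).
  rewrite ge_min lexx orbT => /(_ isT); rewrite ler_pdivlMr ?mulr_gt0 //; lra.
have : `|E (fun c => gen t c - (1 + lin t c + (lin t c ^+ 2 - sq t c) / 2))| <= C * e ^+ 3.
  apply: le_trans (EE_norm fiber_b _) _; rewrite -[leRHS](EE_cst fiber_b).
  by apply: le_EE => // c bc; apply: HC; rewrite ?e0.
rewrite EEB (_ : E (fun c => 1 + lin t c + (lin t c ^+ 2 - sq t c) / 2) = 1 + hess / 2 * v); last first.
  rewrite EED EED EE_cst // EE_lin // addr0; congr (_ + _).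
  rewrite (eq_EE _ (g := fun c => 2^-1 * (lin t c ^+ 2 - sq t c))); last first.
    by move=> c _; rewrite mulrC.
  by rewrite EEZ EEB EE_lin2 // EE_sq /hess -/v; field.
have Cev : C * e ^+ 3 <= `|hess| / 2 * v.
  rewrite exprSr ev mulrCA mulrC ler_wpM2r // (le_trans _ eh) // ler_wpM2r //; lra.
rewrite ler_norml => /andP[l1 l2]; split=> [hneg|hpos].
  by move: Cev; rewrite ltr0_norm //; lra.
by move: Cev; rewrite gtr0_norm //; lra.
Qed.

End Perturbation.
End Moments.

(** * Second moment from the exchange identity *)

Section SecondMoment.
Context (R : realType) (N k M : nat) (b : 'I_N -> 'I_k).
Hypothesis k_gt1 : (1 < k)%N.
Hypothesis fiber_b : forall i, (\sum_(x < N) (b x == i) = M)%N.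
Local Notation conf := {ffun 'I_N -> 'I_k}.
Local Notation E := (@EE R N k M b).
Local Notation dv := (@dev R N k M b).
Implicit Types (c : conf).

Definition hop0 : R := M%:R / k%:R * (M%:R + 1 - M%:R / k%:R).
Definition hop1 : R := M%:R + 1 - 2 * (M%:R / k%:R).

Lemma hopE c i j : (hop M (cnt b c i j))%:R = hop0 + hop1 * dv c i j - dv c i j ^+ 2 :> R.
Proof.
have le := cnt_le fiber_b c i j.
rewrite /hop natrM natrB; last by lia.
by rewrite /hop0 /hop1 /dev -[M.+1]addn1 natrD; ring.
Qed.

(** This is [exchange_identity] with G n = n - M / k: the successor adds 1 to G, which leaves the
    right-hand side. *)
Lemma EE_exchange i i' j j' : i != i' -> j != j' ->
  E (fun c => dv c i j *
       ((hop M (cnt b c i j))%:R * (hop M (cnt b c i' j'))%:R -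
        (hop M (cnt b c i j'))%:R * (hop M (cnt b c i' j))%:R)) =
  E (fun c => (hop M (cnt b c i j'))%:R * (hop M (cnt b c i' j))%:R).
Proof.
move=> ii jj.
have H := congr1 (fun z => z / \sum_(c | bal M c) (wt M b c)%:R)
  (exchange_identity fiber_b (fun n => n%:R - M%:R / k%:R : R) ii jj).
rewrite (eq_EE _ (g := fun c =>
  dv c i j * (hop M (cnt b c i j))%:R * (hop M (cnt b c i' j'))%:R -
  dv c i j * ((hop M (cnt b c i j'))%:R * (hop M (cnt b c i' j))%:R))); last first.
  by move=> c _; ring.
rewrite EEB [X in X - _]H -[X in X - _]/(E (fun c =>
  ((cnt b c i j).+1%:R - M%:R / k%:R) * (hop M (cnt b c i j'))%:R * (hop M (cnt b c i' j))%:R)).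
rewrite -EEB; apply: eq_EE => c _.
by rewrite -[(cnt b c i j).+1]addn1 natrD /dev; ring.
Qed.

Let kR0 : 0 < k%:R :> R. Proof. by rewrite ltr0n; lia. Qed.
Let kR2 : 2 <= k%:R :> R. Proof. by rewrite ler_nat. Qed.

Lemma mean_bounds : 0 <= (M%:R / k%:R : R) <= M%:R / 2.
Proof.
have M0 : 0 <= M%:R :> R by rewrite ler0n.
by rewrite divr_ge0 ?(ltW kR0) //= ler_wpM2l // lef_pV2 // posrE.
Qed.

Lemma hop0_le : (0 < M)%N -> 0 <= hop0 <= M%:R ^+ 2.
Proof.
rewrite -(ler1n R) => M1; have /andP[x0 x1] := mean_bounds.
by rewrite /hop0; apply/andP; split; nra.
Qed.

Lemma hop0_ge : M%:R ^+ 2 / (2 * k%:R) <= hop0.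
Proof.
have M0 : 0 <= M%:R :> R by rewrite ler0n.
have /andP[x0 x1] := mean_bounds.
rewrite (_ : _ / _ = M%:R / k%:R * (M%:R / 2)); last by field; rewrite gt_eqF.
by rewrite /hop0 ler_wpM2l //; lra.
Qed.

Lemma hop1_dev c i j : (0 < M)%N -> `|hop1 - dv c i j| <= 2 * M%:R.
Proof.
rewrite -(ler1n R) => M1; have /andP[x0 x1] := mean_bounds.
have le : (cnt b c i j)%:R <= M%:R :> R by rewrite ler_nat (cnt_le fiber_b).
have ge : 0 <= (cnt b c i j)%:R :> R by rewrite ler0n.
by rewrite /hop1 /dev ler_norml; apply/andP; split; lra.
Qed.

Definition third_moment (i j : 'I_k) : R := E (fun c => `|dv c i j| ^+ 3).

Lemma second_moment_le i j : E (fun c => dv c i j ^+ 2) <= kappa R M b i j.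
Proof.
have k2 := kR2; rewrite /kappa ler_peMl //; last first.
  by rewrite exprn_ege1 // ler_pdivlMr; lra.
rewrite -(EE_cst fiber_b 0); apply: le_EE => // c _; exact: sqr_ge0.
Qed.

(** Expanding every [hop] in [EE_exchange] about M / k leaves the main terms below; the rest is
    bounded by second and third absolute moments. *)
Lemma second_moment_estimate i i' j j' : i != i' -> j != j' -> (0 < M)%N ->
  `|hop0 * hop1 * kappa R M b i j - hop0 ^+ 2| <=
  M%:R ^+ 2 * (6 * kappa R M b i j + 48 * third_moment i j).
Proof.
move=> ii jj M0.
have [/andP[h0 h0M] K] := (hop0_le M0, second_moment_le i j).
set S := E (fun c => dv c i j ^+ 2) in K.
have m2 u v : E (fun c => dv c u v ^+ 2) = S.
  exact: (EE_cell fiber_b (fun n => (n%:R - M%:R / k%:R) ^+ 2)).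
have m3 u v : E (fun c => `|dv c u v| ^+ 3) = third_moment i j.
  exact: (EE_cell fiber_b (fun n => `|n%:R - M%:R / k%:R| ^+ 3)).
have S0 : 0 <= S.
  rewrite -(EE_cst fiber_b 0); apply: le_EE => // c _; exact: sqr_ge0.
(* Since [hop] minus [hop0] is d (hop1 - d), [Y] is the product of the non-constant parts of two
   hops. *)
pose Y u v u' v' c := dv c u v * dv c u' v' * ((hop1 - dv c u v) * (hop1 - dv c u' v')).
have HY u v u' v' c : `|Y u v u' v' c| <= 4 * M%:R ^+ 2 * (`|dv c u v| * `|dv c u' v'|).
  rewrite /Y !normrM mulrC ler_wpM2r ?mulr_ge0 //.
  apply: le_trans (ler_pM _ _ (hop1_dev _ _ _ M0) (hop1_dev _ _ _ M0)) _ => //.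
  by rewrite le_eqVlt; apply/orP; left; apply/eqP; ring.
(* By [covariance] the four coefficients add up to (1 - 1/k)^2 + 1/k^2 + 2 (1 - 1/k)/k = 1. *)
have L1 : E (fun c => dv c i j * (dv c i j + dv c i' j' - dv c i j' - dv c i' j)) =
          kappa R M b i j.
  rewrite (eq_EE _ (g := fun c => dv c i j * dv c i j + dv c i j * dv c i' j'
     - dv c i j * dv c i j' - dv c i j * dv c i' j)); last by move=> c _; ring.
  rewrite !EEB EED !(covariance R k_gt1 fiber_b i j) !eqxx (negPf ii) (negPf jj) /=.
  by rewrite mulr1n mulr0n; field; rewrite gt_eqF.
(* [W] collects what is quadratic or higher in the deviations; multiplied by one more deviation it
   is of third order. *)
pose W c := - hop0 * (dv c i j ^+ 2 + dv c i' j' ^+ 2 - dv c i j' ^+ 2 - dv c i' j ^+ 2)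
            + Y i j i' j' c - Y i j' i' j c.
have transpose (x y z t : R) : x + t = y + z -> x - y = z - t by move=> *; lra.
have := EE_exchange ii jj.
rewrite (eq_EE _ (g := fun c => hop0 * hop1 *
   (dv c i j * (dv c i j + dv c i' j' - dv c i j' - dv c i' j)) + dv c i j * W c));
  last by move=> c _; rewrite !hopE /W /Y; ring.
rewrite EED EEZ L1.
rewrite [RHS](eq_EE _ (g := fun c => hop0 ^+ 2 + hop0 * hop1 * (dv c i j' + dv c i' j)
   + (- hop0 * (dv c i j' ^+ 2 + dv c i' j ^+ 2) + Y i j' i' j c)));
  last by move=> c _; rewrite !hopE /Y; ring.
rewrite EED EED EEZ EED !EE_dev // EE_cst // addr0 mulr0 addr0 => H.
have -> : hop0 * hop1 * kappa R M b i j - hop0 ^+ 2 =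
  E (fun c => - hop0 * (dv c i j' ^+ 2 + dv c i' j ^+ 2) + Y i j' i' j c)
  - E (fun c => dv c i j * W c) by apply: transpose H.
apply: le_trans (ler_normB _ _) _; rewrite mulrDr; apply: lerD.
  apply: le_trans (EE_norm fiber_b _) _.
  apply: (@le_trans _ _ (E (fun c => 3 * M%:R ^+ 2 * (dv c i j' ^+ 2 + dv c i' j ^+ 2)))); last first.
    rewrite EEZ EED !m2; nra.
  apply: le_EE => // c _; apply: le_trans (ler_normD _ _) _.
  have -> : `|- hop0 * (dv c i j' ^+ 2 + dv c i' j ^+ 2)| = hop0 * (dv c i j' ^+ 2 + dv c i' j ^+ 2).
    by rewrite normrM normrN !ger0_norm ?addr_ge0 ?sqr_ge0.
  have := HY i j' i' j c; rewrite -(real_normK (num_real (dv c i j'))).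
  rewrite -(real_normK (num_real (dv c i' j))).
  move: `|dv c i j'| `|dv c i' j| => u v Huv.
  have := ler_wpM2r (addr_ge0 (sqr_ge0 u) (sqr_ge0 v)) h0M.
  have := mulr_ge0 (sqr_ge0 M%:R) (sqr_ge0 (u - v)).
  lra.
apply: le_trans (EE_norm fiber_b _) _.
apply: (@le_trans _ _ (E (fun c => M%:R ^+ 2 * (12 * (`|dv c i j| ^+ 3 + `|dv c i' j'| ^+ 3
  + `|dv c i j'| ^+ 3 + `|dv c i' j| ^+ 3))))); last first.
  by rewrite !EEZ !EED !m3; lra.
apply: le_EE => // c _; rewrite normrM.
have Wle : `|W c| <= M%:R ^+ 2 * (`|dv c i j| ^+ 2 + `|dv c i' j'| ^+ 2 + `|dv c i j'| ^+ 2
    + `|dv c i' j| ^+ 2 + 4 * (`|dv c i j| * `|dv c i' j'|)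
    + 4 * (`|dv c i j'| * `|dv c i' j|)).
  rewrite /W; apply: le_trans (ler_normB _ _) _; rewrite [leRHS]mulrDr lerD //; last first.
    by rewrite mulrA [_ * 4]mulrC.
  apply: le_trans (ler_normD _ _) _; rewrite [leRHS]mulrDr lerD //; last first.
    by rewrite mulrA [_ * 4]mulrC.
  rewrite normrM normrN (ger0_norm h0) ler_pM // !real_normK ?num_real //.
  have := sqr_ge0 (dv c i j); have := sqr_ge0 (dv c i' j').
  have := sqr_ge0 (dv c i j'); have := sqr_ge0 (dv c i' j).
  by rewrite ler_norml => *; apply/andP; split; lra.
apply: le_trans (ler_wpM2l (normr_ge0 _) Wle) _; rewrite mulrCA ler_wpM2l ?sqr_ge0 //.
move: (normr_ge0 (dv c i j)) (normr_ge0 (dv c i' j')) (normr_ge0 (dv c i j')) (normr_ge0 (dv c i' j)).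
move: `|dv c i j| `|dv c i' j'| `|dv c i j'| `|dv c i' j| => x y z w x0 y0 z0 w0.
(* Mixed products of three deviations are reduced to cubes, whose expectations agree for all
   cells. *)
have amgm u v t : 0 <= u -> 0 <= v -> 0 <= t -> 3 * (u * v * t) <= u ^+ 3 + v ^+ 3 + t ^+ 3 :> R.
  move=> u0 v0 t0; rewrite -subr_ge0.
  rewrite (_ : _ - _ = (u + v + t) * ((u - v) ^+ 2 + (v - t) ^+ 2 + (t - u) ^+ 2) / 2); last by field.
  by rewrite !mulr_ge0 ?addr_ge0 ?sqr_ge0.
have := amgm _ _ _ x0 y0 y0; have := amgm _ _ _ x0 z0 z0; have := amgm _ _ _ x0 w0 w0.
have := amgm _ _ _ x0 x0 y0; have := amgm _ _ _ x0 z0 w0.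
have := exprn_ge0 3 x0; have := exprn_ge0 3 y0; have := exprn_ge0 3 z0; have := exprn_ge0 3 w0.
lra.
Qed.

End SecondMoment.

(** For k = 2 the four deviations are d or -d and [hop1] is 1, so with y = [hop0] the exchange
    identity reads E[4 y d^2 - 4 d^4] = E[(y - d^2 - d)^2]. Dropping d^4 on the left and applying
    Jensen on the right gives the bound. *)
Lemma second_moment_two (R : realType) (N M : nat) (b : 'I_N -> 'I_2) i j :
  (forall i, (\sum_(x < N) (b x == i) = M)%N) ->
  (hop0 R 2 M - kappa R M b i j / 4) ^+ 2 <= hop0 R 2 M * kappa R M b i j.
Proof.
move=> fiber_b; set E := @EE R N 2 M b; set dv := @dev R N 2 M b.
set S := E (fun c => dv c i j ^+ 2).
have -> : kappa R M b i j = 4 * S by rewrite /kappa -[@EE _ _ _ _ _ _]/S; field.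
have -> : S = E (fun c => dv c ord0 ord0 ^+ 2).
  exact: (EE_cell fiber_b (fun n => (n%:R - M%:R / 2%:R) ^+ 2)).
set o := lift ord0 ord0 : 'I_2.
have d01 c : bal M c -> dv c ord0 o = - dv c ord0 ord0.
  move=> bc; have := dev_row R (isT : (1 < 2)%N) fiber_b c ord0.
  by rewrite !big_ord_recl big_ord0 addr0 -/dv -/o; lra.
have d10 c : bal M c -> dv c o ord0 = - dv c ord0 ord0.
  move=> bc; have := dev_col R b (isT : (1 < 2)%N) ord0 bc.
  by rewrite !big_ord_recl big_ord0 addr0 -/dv -/o; lra.
have d11 c : bal M c -> dv c o o = dv c ord0 ord0.
  move=> bc; have := dev_row R (isT : (1 < 2)%N) fiber_b c o.
  by rewrite !big_ord_recl big_ord0 addr0 -/dv -/o d10 //; lra.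
have hop1E : hop1 R 2 M = 1 by rewrite /hop1; field.
have := EE_exchange R fiber_b (isT : ord0 != o) (isT : ord0 != o).
set y := hop0 R 2 M; set s := E (fun c => _).
rewrite (eq_EE _ (g := fun c => 4 * y * dv c ord0 ord0 ^+ 2 - 4 * dv c ord0 ord0 ^+ 4)); last first.
  move=> c bc; rewrite !(hopE _ (isT : (1 < 2)%N) fiber_b) -/dv hop1E d01 // d10 // d11 // -/y; ring.
have le1 : E (fun c => 4 * y * dv c ord0 ord0 ^+ 2 - 4 * dv c ord0 ord0 ^+ 4) <= 4 * y * s.
  rewrite /s -EEZ; apply: le_EE => // c bc; rewrite lerBlDr lerDl mulr_ge0 //.
  by rewrite exprn_even_ge0.
have le2 : (y - s) ^+ 2 <= E (fun c => (hop M (cnt b c ord0 o))%:R * (hop M (cnt b c o ord0))%:R).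
  (* Jensen's inequality via the tangent to the square at the mean y - s of y - d^2 - d. *)
  apply: (@le_trans _ _ (E (fun c => 2 * (y - s) * (y - dv c ord0 ord0 ^+ 2)
     - 2 * (y - s) * dv c ord0 ord0 - (y - s) ^+ 2))); last first.
    apply: le_EE => // c bc; rewrite !(hopE _ (isT : (1 < 2)%N) fiber_b) -/dv hop1E d01 // d10 // -/y.
    rewrite -subr_ge0; apply: le_trans (sqr_ge0 (y - dv c ord0 ord0 ^+ 2 - dv c ord0 ord0 - (y - s))) _.
    by rewrite le_eqVlt; apply/orP; left; apply/eqP; ring.
  rewrite /s /E EEB EEB !EEZ EEB !EE_cst // EE_dev // mulr0.
  by rewrite le_eqVlt; apply/orP; left; apply/eqP; ring.
move=> H; move: le2; rewrite /E -H => /le_trans /(_ le1).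
by rewrite (_ : 4 * s / 4 = s); [lra | field].
Qed.

(** * Concentration *)

Section Concentration.
Context (N k M : nat) (b : 'I_N -> 'I_k).
Hypothesis k_gt2 : (2 < k)%N.
Hypothesis fiber_b : forall i, (\sum_(x < N) (b x == i) = M)%N.
Local Notation conf := {ffun 'I_N -> 'I_k}.
Local Notation table := ('I_k -> 'I_k -> nat).
Implicit Types (c : conf) (g : table).

Definition has_counts g c : bool := [forall i, forall j, cnt b c i j == g i j].

Lemma has_countsP g c : reflect (forall i j, cnt b c i j = g i j) (has_counts g c).
Proof.
apply: (iffP forallP) => [H i j|H i]; first by have /forallP/(_ j)/eqP := H i.
by apply/forallP => j; rewrite H.
Qed.

(* No column condition here: the total weight of all configurations with the
   given table of counts. *)
Definition mass g : nat := (\sum_(c | has_counts g c) wt M b c)%N.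

Lemma eq_mass g g' : (forall i j, g i j = g' i j) -> mass g = mass g'.
Proof.
move=> gg; apply: eq_bigl => c; apply: eq_forallb => i; apply: eq_forallb => j.
by rewrite gg.
Qed.

Definition transfer g (i a a' : 'I_k) : table :=
  fun u v => (g u v + ((u == i) && (v == a')) - ((u == i) && (v == a)))%N.

(** Double counting of a colouring together with a row of block [i] to be recoloured from [a] to
    [a']; [wt_upd] compares the weights. *)
Lemma mass_transfer g i a a' : a != a' -> (0 < g i a)%N ->
  (mass g * hop M (g i a) = mass (transfer g i a a') * hop M (g i a').+1)%N.
Proof.
move=> aa ga.
have point (h : table) u (F : conf -> nat) :
    (\sum_(c | has_counts h c) F c * h i u =
     \sum_(x | b x == i) \sum_(c | has_counts h c && (c x == u)) F c)%N.
  rewrite (exchange_big_dep (has_counts h)) /=; last by move=> x c _ /andP[].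
  apply: eq_bigr => c hc; rewrite -(has_countsP _ _ hc) /cnt big_distrr /=.
  rewrite [LHS]big_mkcond [RHS]big_mkcond; apply: eq_bigr => x _.
  by rewrite hc; case: (b x == i); case: eqP; rewrite /= ?muln1 ?muln0.
transitivity (\sum_(c | has_counts g c) (wt M b c * (M.+1 - cnt b c i a)) * g i a)%N.
  rewrite big_distrl; apply: eq_bigr => c /has_countsP hc /=.
  by rewrite hc /hop; ring.
transitivity (\sum_(c | has_counts (transfer g i a a') c)
    (wt M b c * (M.+1 - cnt b c i a')) * transfer g i a a' i a')%N; last first.
  rewrite big_distrl; apply: eq_bigr => c /has_countsP hc /=.
  rewrite hc /hop /transfer !eqxx eq_sym (negPf aa) /= subn0 addn1; ring.
rewrite !point; apply: eq_bigr => x /eqP bx.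
rewrite (reindex_onto (fun c => upd c x a) (fun c => upd c x a')) /=; last first.
  move=> c /andP[_ /eqP cx]; apply/ffunP => z; rewrite !ffunE.
  by case: eqP => // ->; rewrite cx.
apply: eq_big => c.
  rewrite ffunE eqxx eqxx andbT.
  have -> : (upd (upd c x a) x a' == c) = (c x == a').
    apply/eqP/eqP => [<-|cx]; first by rewrite ffunE eqxx.
    by apply/ffunP => z; rewrite !ffunE; case: eqP => // ->.
  case: eqP => cx; rewrite ?andbF // !andbT.
  have H u v := cnt_upd b c x a u v.
  apply/has_countsP/has_countsP => hc u v; have := H u v; rewrite bx cx.
    rewrite hc /transfer ![i == u]eq_sym ![_ == v]eq_sym.
    have [->|ui] := eqVneq u i => /=; last by lia.
    by case: eqVneq => va /=; case: eqVneq => va' /=; lia.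
  rewrite hc /transfer ![i == u]eq_sym ![_ == v]eq_sym.
  have [->|ui] := eqVneq u i => /=; last by lia.
  have [->|va] /= := eqVneq v a; have [va'|va'] /= := eqVneq v a'; lia.
move=> /andP[/andP[_ _] /eqP E].
have cx : c x = a' by rewrite -E ffunE eqxx.
have /(wt_upd fiber_b) : c x != a by rewrite cx eq_sym.
rewrite bx cx => <-; congr (_ * _)%N.
have := cnt_upd b c x a i a; rewrite bx cx !eqxx eq_sym (negPf aa) /=.
lia.
Qed.

(** The remainder of M modulo k is spread along cyclic diagonals, so that rows and columns all sum
    to M. *)
Definition balanced_table : table :=
  fun i j => (M %/ k + ((i + j) %% k < M %% k))%N.

Let k_gt0 : (0 < k)%N. Proof. by lia. Qed.

Lemma sum_shift (i : nat) (f : nat -> nat) :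
  (\sum_(j < k) f ((i + j) %% k) = \sum_(j < k) f j)%N.
Proof.
pose s (j : 'I_k) := Ordinal (ltn_pmod (i + j) k_gt0).
have sI : injective s.
  move=> j j' [/eqP]; rewrite eqn_modDl !modn_small // => /eqP.
  exact: val_inj.
by rewrite [RHS](reindex_inj sI).
Qed.

Lemma sum_ord_lt r : (r <= k)%N -> (\sum_(j < k) (j < r) = r)%N.
Proof.
move=> rk; rewrite (eq_bigr (fun j : 'I_k => if (j < r)%N then 1 else 0)%N) => [|j _].
  by rewrite -big_mkcond -(big_ord_widen k (fun=> 1%N) rk) sum1_card card_ord.
by case: ltnP.
Qed.

Lemma balanced_row i : (\sum_j balanced_table i j = M)%N.
Proof.
rewrite big_split sum_nat_const card_ord (sum_shift i (fun n => n < M %% k)%N).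
by rewrite sum_ord_lt 1?ltnW ?ltn_pmod // [RHS](divn_eq M k) mulnC.
Qed.

Lemma balanced_col j : (\sum_i balanced_table i j = M)%N.
Proof.
rewrite -[RHS](balanced_row j); apply: eq_bigr => i _.
by rewrite /balanced_table addnC [(i + j)%N]addnC addnC.
Qed.

(** * Geometric decay of the mass away from the balanced table *)

Section Decay.
Context (d : nat).
Local Notation g0 := balanced_table.

Definition excess g : nat := (\sum_i \sum_j (g i j - g0 i j))%N.
(* Counts are capped at M - 1 because the first transfer out of a single-coloured
   block gains nothing: hop M = hop 1. *)
Definition heavy g : nat := (\sum_i \sum_j (minn (g i j) M.-1 - g0 i j - d))%N.

Lemma sum_cell (F G : 'I_k -> 'I_k -> nat) i a n : 
  (forall u v, (u, v) != (i, a) -> F u v <= G u v)%N -> (F i a <= G i a + n)%N ->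
  (\sum_u \sum_v F u v <= \sum_u \sum_v G u v + n)%N.
Proof.
move=> FG Fia; rewrite !pair_bigA /= (bigD1 (i, a)) //= [in leqRHS](bigD1 (i, a)) //=.
rewrite addnAC leq_add // leq_sum // => -[u v] ne; exact: FG.
Qed.

(** A row of block [i] moves from an over-full colour [a] to the least used colour [a']. The mass
    never drops, and it gains a factor 1 + d / (2M) when the cell is more than d above balance and
    does not fill the block. *)
Lemma transfer_step g i a : (forall u, \sum_j g u j = M)%N -> (g0 i a < g i a)%N ->
  exists a', let g' := transfer g i a a' in
  [/\ (forall u, \sum_j g' u j = M)%N, (excess g' < excess g)%N,
      (heavy g <= heavy g' + ((g0 i a + d < g i a) && (g i a < M)))%N,
      (0 < hop M (g i a').+1)%N /\ (mass g * hop M (g i a) = mass g' * hop M (g i a').+1)%N &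
      (hop M (g i a').+1 <= hop M (g i a))%N /\
      ((g0 i a + d < g i a)%N -> (g i a < M)%N ->
       (2 * M + d) * hop M (g i a').+1 <= 2 * M * hop M (g i a))%N].
Proof.
move=> rowg ga.
have [j0 Hj0] : exists j, (g i j < g0 i j)%N.
  apply/existsP; apply: contraT; rewrite negb_exists => /forallP H.
  suff : (\sum_j g0 i j < \sum_j g i j)%N by rewrite rowg balanced_row ltnn.
  rewrite (bigD1 a) //= [in ltnRHS](bigD1 a) //= -addSn leq_add // leq_sum // => j _.
  by rewrite leqNgt H.
case: (@arg_minnP _ j0 (fun j => g i j < g0 i j)%N (fun j => g i j) Hj0) => a' ga' Hmin.
have g0q u v : (M %/ k <= g0 u v <= (M %/ k).+1)%N.
  by rewrite /balanced_table; case: (_ < _)%N; rewrite ?addn0 ?addn1 leqnn leqnSn.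
(* Minimality among deficient colours is minimality among all: the other counts are at least M %/ k,
   and balanced entries differ by at most 1. *)
have gmin j : (g i a' <= g i j)%N.
  have [|jge] := ltnP (g i j) (g0 i j); first exact: Hmin.
  have := g0q i j; have := g0q i a'; lia.
have aa : a != a' by apply: contraTneq ga' => <-; rewrite -leqNgt ltnW.
(* Here k >= 3 enters: a third colour, used at least B = g i a' times, gives M - A - B >= B with A =
   g i a. *)
have [a3 /andP[a3a a3a']] : exists j, (j != a) && (j != a').
  have /card_gt0P[j] : (0 < #|~: [set a; a']|)%N.
    by rewrite cardsCs finset.setCK cards2 card_ord; lia.
  by rewrite !inE negb_or => /andP[ja ja']; exists j; rewrite ja ja'.
have sum3 : (g i a + g i a' + g i a3 <= M)%N.
  rewrite -(rowg i) (bigD1 a) //= (bigD1 a') 1?eq_sym //= (bigD1 a3) /=; last first.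
    by rewrite a3a a3a'.
  by rewrite !addnA leq_addr.
have gmin3 := gmin a3; have q1 := g0q i a; have q2 := g0q i a'.
have le_aa' : ((g i a').+1 <= g i a)%N by lia.
exists a'; split.
- move=> u; rewrite -[RHS](rowg u).
  have [ui|ui] := eqVneq u i; last first.
    by apply: eq_bigr => j _; rewrite /transfer (negPf ui) /= addn0 subn0.
  rewrite ui (bigD1 a) //= (bigD1 a') 1?eq_sym //= [RHS](bigD1 a) //=.
  rewrite [in RHS](bigD1 a') 1?eq_sym //=.
  rewrite (eq_bigr (fun j => g i j)).
    rewrite /transfer !eqxx (negPf aa) [a' == a]eq_sym (negPf aa) /=.
    by set S := (\sum_(_ < _ | _) _)%N; lia.
  by move=> j /andP[ja ja']; rewrite /transfer (negPf ja) (negPf ja') !andbF addn0 subn0.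
- have H := @sum_cell (fun u v => transfer g i a a' u v - g0 u v)%N
    (fun u v => if (u, v) == (i, a) then g u v - g0 u v - 1 else g u v - g0 u v)%N i a 0.
  rewrite /excess; apply: leq_ltn_trans (H _ _) _.
  + move=> u v uv; rewrite (negPf uv); move: uv; rewrite xpair_eqE /transfer.
    have [->|ui] := eqVneq u i => /=; last by lia.
    move=> va; rewrite (negPf va) subn0; have [->|] := eqVneq v a'; rewrite /=; lia.
  + by rewrite eqxx /transfer !eqxx (negPf aa) /=; lia.
  + rewrite addn0 !pair_bigA /= (bigD1 (i, a)) //= [in ltnRHS](bigD1 (i, a)) //= eqxx.
    rewrite -addSn leq_add //; first by lia.
    by apply: leq_sum => -[u v] uv /=; rewrite (negPf uv).
- apply: (@sum_cell _ _ i a) => [u v|]; last first.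
    rewrite /transfer !eqxx (negPf aa) /=; have := g0q i a.
    by case: (ltnP (g0 i a + d) (g i a)); case: (ltnP (g i a) M); rewrite /=; lia.
  rewrite xpair_eqE /transfer; have [->|ui] := eqVneq u i => /=; last by lia.
  by move=> va; rewrite (negPf va); lia.
- split; first by rewrite muln_gt0; lia.
  by apply: mass_transfer => //; lia.
- move: (g i a) (g i a') (g i a3) (g0 i a) (g0 i a') (M %/ k)%N sum3 gmin3 q1 q2 le_aa' ga ga'.
  move=> A B C G G' q sum3 gmin3 q1 q2 le_aa' ga ga'.
  have -> : hop M B.+1 = ((B + 1) * (M - B))%N by rewrite /hop subSS addn1.
  have Ediff : (hop M A = (B + 1) * (M - B) + (A - B - 1) * (M - A - B))%N.
    rewrite /hop; have [A' EA] : exists A', A = (B + 1 + A')%N by exists (A - B - 1)%N; lia.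
    subst A.
    have [M' ->] : exists M', M = (B + 1 + A' + B + M')%N by exists (M - (B + 1 + A' + B))%N; lia.
    have -> : ((B + 1 + A' + B + M').+1 - (B + 1 + A') = M' + B + 1)%N by lia.
    have -> : (B + 1 + A' + B + M' - B = 1 + A' + B + M')%N by lia.
    have -> : (B + 1 + A' - B - 1 = A')%N by lia.
    have -> : (B + 1 + A' + B + M' - (B + 1 + A') - B = M')%N by lia.
    ring.
  split; first by rewrite Ediff leq_addr.
  move=> dA AM; rewrite Ediff mulnDl mulnDr leq_add2l.
  have h1 : (d <= A - B - 1)%N by lia.
  (* It suffices that B + 1 <= 2 (M - A - B), which follows from M - A - B >= B if B > 0 and from A
     < M if B = 0. *)
  have h2 : ((B + 1) * (M - B) <= 2 * M * (M - A - B))%N.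
    apply: (@leq_trans ((B + 1) * M)%N); first by rewrite leq_mul2l leq_subr orbT.
    rewrite mulnAC leq_mul2r; apply/orP; right; lia.
  apply: leq_trans (leq_mul h1 h2) _; by rewrite mulnCA.
Qed.

(** Transfers strictly lower [excess], and each one that lowers [heavy] lowers it by at most 1 and
    gains the factor rho. Once no cell exceeds the balanced table, equal row sums force equality
    with it. *)
Lemma mass_decay (R : realType) g : (0 < M)%N -> (forall u, \sum_j g u j = M)%N ->
  (mass g)%:R * (1 + d%:R / (2 * M%:R)) ^+ heavy g <= (mass g0)%:R :> R.
Proof.
move=> M0; have M0R : 0 < M%:R :> R by rewrite ltr0n.
set rho : R := _ + _; have rho1 : 1 <= rho by rewrite lerDl divr_ge0 // mulr_ge0 ?ltW.
have rho0 : 0 <= rho by apply: le_trans rho1.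
have [n] := ubnP (excess g); elim: n g => // n IH g /ltnSE gn rowg.
have step i a (e : nat) : (g0 i a < g i a)%N ->
    (e = ((g0 i a + d < g i a) && (g i a < M)) :> nat)%N ->
    (mass g)%:R * rho ^+ heavy g <= (mass g0)%:R.
  move=> ga eE; have [a' /= [rowg' ex hv [h0 hm] [hle hlt]]] := transfer_step rowg ga.
  apply: le_trans (IH _ (leq_trans ex gn) rowg'); rewrite -eE in hv.
  apply: (@le_trans _ _ ((mass g)%:R * rho ^+ (heavy (transfer g i a a') + e))).
    by rewrite ler_wpM2l ?ler0n // ler_weXn2l.
  rewrite addnC exprD mulrA ler_wpM2r ?exprn_ge0 //.
  have h0R : 0 < (hop M (g i a').+1)%:R :> R by rewrite ltr0n.
  rewrite -(ler_pM2r h0R) -[leRHS]natrM -hm natrM -mulrA ler_wpM2l ?ler0n //.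
  rewrite eE; case: (ltnP (g0 i a + d) (g i a)) => [lt1|_] /=; last first.
    by rewrite expr0 mul1r ler_nat.
  case: (ltnP (g i a) M) => [lt2|_]; last by rewrite expr0 mul1r ler_nat.
  have := hlt lt1 lt2; rewrite -(ler_nat R) !natrM natrD natrM => H.
  rewrite expr1 -(ler_pM2l (_ : 0 < 2 * M%:R)) ?mulr_gt0 // mulrA; apply: le_trans H.
  by rewrite le_eqVlt; apply/orP; left; apply/eqP; rewrite /rho; field; rewrite gt_eqF.
have [/existsP[i /existsP[a ia]]|nex] := boolP [exists i, exists a, g0 i a + d < g i a]%N.
  by apply: step erefl; apply: leq_ltn_trans ia; rewrite leq_addr.
have heavy0 : heavy g = 0%N.
  apply: big1 => i _; apply: big1 => a _; apply/eqP; rewrite -subnDA subn_eq0.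
  move: nex; rewrite negb_exists => /forallP/(_ i); rewrite negb_exists => /forallP/(_ a).
  by rewrite -leqNgt geq_min => ->.
have [/existsP[i /existsP[a ia]]|nex0] := boolP [exists i, exists a, g0 i a < g i a]%N.
  exact: step ia erefl.
rewrite heavy0 expr0 mulr1 (@eq_mass g g0) // => i.
have le j : (g i j <= g0 i j)%N.
  move: nex0; rewrite negb_exists => /forallP/(_ i); rewrite negb_exists => /forallP/(_ j).
  by rewrite -leqNgt.
have /eqP : (\sum_j g i j = \sum_j g0 i j)%N by rewrite rowg balanced_row.
move=> /eqP S j; apply/eqP; rewrite eqn_leq le /=; apply: contraT; rewrite -ltnNge => lt.
suff : (\sum_j g i j < \sum_j g0 i j)%N by rewrite S ltnn.
rewrite (bigD1 j) //= [in ltnRHS](bigD1 j) //= -addSn leq_add // leq_sum //.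
Qed.

Definition spread c : bool := [exists i, exists j, g0 i j + 2 * d < cnt b c i j]%N.

(** Union bound over at most (M + 1)^(k^2) tables: each spread table has mass at most that of the
    balanced table over rho^d, and the balanced table has at most the total weight. *)
Lemma spread_mass (R : realType) : (0 < M)%N ->
  EE M b (fun c => (spread c)%:R) <=
  M.+1%:R ^+ (k * k) / (1 + d%:R / (2 * M%:R)) ^+ d :> R.
Proof.
move=> M0; have M0R : 0 < M%:R :> R by rewrite ltr0n.
set rho : R := _ + _; have rho1 : 1 <= rho by rewrite lerDl divr_ge0 // mulr_ge0 ?ltW.
have rho0 : 0 < rho ^+ d by rewrite exprn_gt0 // (lt_le_trans _ rho1).
have Z0 := EE_mass_gt0 R fiber_b.
have g0Z : (mass g0)%:R <= \sum_(c | bal M c) (wt M b c)%:R :> R.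
  rewrite /mass natr_sum [leLHS]big_mkcond [leRHS]big_mkcond; apply: ler_sum => c _.
  case: ifP => [/has_countsP hc|_]; last by case: ifP.
  rewrite ifT //; apply/forallP => j; rewrite -[X in _ == X](balanced_col j); apply/eqP.
  under [RHS]eq_bigr => i _ do rewrite -hc.
  rewrite /cnt (exchange_big_dep predT) //=; apply: eq_bigr => x _.
  rewrite (bigD1 (b x)) //= big1 ?addn0 // => i /andP[/eqP->]; by rewrite eqxx.
rewrite /EE ler_pdivrMr //.
apply: (@le_trans _ _ (M.+1%:R ^+ (k * k) / rho ^+ d * (mass g0)%:R)); last first.
  by apply: ler_wpM2l g0Z; apply: divr_ge0; [exact: exprn_ge0|exact: ltW].
pose tab c : {ffun 'I_k * 'I_k -> 'I_M.+1} := [ffun u => inord (cnt b c u.1 u.2)].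
rewrite (partition_big tab predT) //=.
have -> : M.+1%:R ^+ (k * k) / rho ^+ d * (mass g0)%:R =
    \sum_(t : {ffun 'I_k * 'I_k -> 'I_M.+1}) (mass g0)%:R / rho ^+ d.
  rewrite sumr_const card_ffun card_prod !card_ord -[RHS]mulr_natl natrX.
  by rewrite mulrAC mulrA.
apply: ler_sum => t _; rewrite ler_pdivlMr //.
pose g i j : nat := t (i, j).
have tabP c : tab c == t -> has_counts g c.
  move=> /eqP tc; apply/has_countsP => i j; rewrite /g -tc ffunE inordK //.
  by rewrite ltnS (cnt_le fiber_b).
have [/existsP[c /andP[tc sc]]|none] := boolP [exists c, (tab c == t) && spread c]; last first.
  rewrite big1 ?mul0r // => c /andP[_ tc]; move: none; rewrite negb_exists => /forallP/(_ c).
  by rewrite tc /= => /negPf ->; rewrite mulr0.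
have /has_countsP hc := tabP _ tc.
apply: le_trans (mass_decay R (g := g) M0 _); last first.
  by move=> u; rewrite -[RHS](cnt_row fiber_b c u); apply: eq_bigr => j _; rewrite hc.
apply: ler_pM; rewrite ?sumr_ge0 ?exprn_ge0 ?(le_trans _ rho1) //.
- rewrite /mass natr_sum [leLHS]big_mkcond [leRHS]big_mkcond; apply: ler_sum => c' _.
  case: ifP => [/andP[_ /tabP ->]|_]; last by case: ifP.
  by rewrite ler_piMr ?ler0n // lern1 leq_b1.
(* The cap at M - 1 costs at most one, so an excess above 2d contributes at least d to [heavy]. *)
- rewrite ler_weXn2l //; move: sc => /existsP[i /existsP[j ij]].
  rewrite /heavy (bigD1 i) //= (bigD1 j) //= -addnA; apply: leq_trans (leq_addr _ _).
  rewrite -hc; have := cnt_le fiber_b c i j; lia.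
Qed.

(** Since row sums are fixed, an upper bound on all cells of a row also bounds each cell from below,
    at the cost of a factor k. *)
Lemma dev_not_spread (R : realType) c i j : ~~ spread c ->
  `|dev R M b c i j| <= 2 * (d * k)%:R + 2.
Proof.
move=> ns; have le i' j' : (cnt b c i' j' <= g0 i' j' + 2 * d)%N.
  move: ns; rewrite negb_exists => /forallP/(_ i'); rewrite negb_exists => /forallP/(_ j').
  by rewrite -leqNgt.
have g0q u v : (M %/ k <= g0 u v <= (M %/ k).+1)%N.
  by rewrite /balanced_table; case: (_ < _)%N; rewrite ?addn0 ?addn1 leqnn leqnSn.
have kR : 0 < k%:R :> R by rewrite ltr0n.
have x1 : (M %/ k)%:R <= M%:R / k%:R :> R.
  by rewrite ler_pdivlMr // -natrM ler_nat leq_divM.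
have x2 : M%:R / k%:R <= (M %/ k)%:R + 1 :> R.
  rewrite ler_pdivrMr // natr1 -natrM ler_nat ltnW // [X in (X < _)%N](divn_eq M k).
  by rewrite mulSn addnC ltn_add2r ltn_pmod.
have lo : (g0 i j <= cnt b c i j + 2 * d * k)%N.
  have : (\sum_l g0 i l = \sum_l cnt b c i l)%N by rewrite balanced_row (cnt_row fiber_b).
  rewrite (bigD1 j) //= [RHS](bigD1 j) //=.
  have : (\sum_(l | l != j) cnt b c i l <= \sum_(l | l != j) g0 i l + 2 * d * k)%N.
    apply: (@leq_trans (\sum_(l | l != j) (g0 i l + 2 * d))%N); first exact: leq_sum.
    rewrite big_split leq_add2l sum_nat_const mulnC leq_mul2l -[leqRHS]card_ord max_card.
    by rewrite orbT.
  move: (\sum_(l | l != j) cnt b c i l)%N (\sum_(l | l != j) g0 i l)%N (2 * d * k)%N.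
  lia.
have dk : (d <= d * k)%N by rewrite leq_pmulr.
have hi := le i j; have := g0q i j => /andP[q1 q2].
have {}lo : (M %/ k <= cnt b c i j + 2 * (d * k))%N by lia.
have {}hi : (cnt b c i j <= M %/ k + 1 + 2 * (d * k))%N by lia.
move: lo hi; rewrite -!(ler_nat R) !natrD !natrM => lo hi.
rewrite /dev ler_norml; apply/andP; split; lra.
Qed.

(** Off the event [spread] one deviation is bounded by [dev_not_spread]; on it the trivial bound M
    is used. *)
Lemma third_moment_le (R : realType) i j : (0 < M)%N ->
  third_moment R M b i j <= (2 * (d * k)%:R + 2) * kappa R M b i j
    + M%:R ^+ 3 * (M.+1%:R ^+ (k * k) / (1 + d%:R / (2 * M%:R)) ^+ d).
Proof.
move=> M0; have k_gt1 : (1 < k)%N by lia.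
have kap := second_moment_le R k_gt1 fiber_b i j.
have D0 : 0 <= 2 * (d * k)%:R + 2 :> R by rewrite addr_ge0 ?mulr_ge0.
apply: le_trans (lerD (ler_wpM2l D0 kap)
  (ler_wpM2l (exprn_ge0 3 (ler0n R M)) (spread_mass R M0))).
rewrite -!EEZ -EED; apply: le_EE => // c _.
have [sc|nsc] := boolP (spread c); last first.
  rewrite mulr0n mulr0 addr0 exprS real_normK ?num_real // ler_wpM2r ?sqr_ge0 //.
  exact: dev_not_spread.
rewrite mulr1n mulr1; apply: ler_wpDl; first by rewrite mulr_ge0 ?sqr_ge0.
rewrite lerXn2r ?nnegrE //.
have le : (cnt b c i j)%:R <= M%:R :> R by rewrite ler_nat (cnt_le fiber_b).
have ge : 0 <= (cnt b c i j)%:R :> R by rewrite ler0n.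
have /andP[x0 x1] := mean_bounds R M k_gt1.
by rewrite /dev ler_norml; apply/andP; split; lra.
Qed.

End Decay.
End Concentration.

(** * Sign of the Hessian for large M *)

Local Open Scope classical_set_scope.

Lemma bernoulli (R : realFieldType) (x : R) n : 0 <= x -> n%:R * x <= (1 + x) ^+ n.
Proof.
move=> x0; elim: n => [|n IH]; first by rewrite mul0r expr0.
rewrite exprS mulrDl mul1r -natr1 mulrDl mul1r lerD // ler_peMr //.
by rewrite exprn_ege1 // lerDl.
Qed.

Lemma ord_neq k (i : 'I_k) : (1 < k)%N -> exists i', i != i'.
Proof.
case: k i => [|[|k]] // i _; have [->|i0] := eqVneq i ord0; last by exists ord0.
by exists (lift ord0 ord0).
Qed.

Lemma near_ge (R : realType) (x : R) : \forall M \near \oo, x <= M%:R.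
Proof. exact: nbhs_infty_ger. Qed.

(** With d proportional to M the base of the power stays away from 1, and exponential decay beats
    the polynomial number of tables. *)
Lemma tail_small (R : realType) (k e : nat) (eps : R) : (0 < e)%N -> 0 < eps ->
  \forall M \near \oo,
    M%:R ^+ 3 * (M.+1%:R ^+ (k * k) / (1 + (M %/ e)%:R / (2 * M%:R)) ^+ (M %/ e))
      <= eps * M%:R ^+ 2 :> R.
Proof.
(* Bernoulli applied to p blocks of d %/ p factors gives (1 + x)^d >= (c M)^p. The exponent p = k^2
   + 2 leaves one power of M; c comes from d %/ p >= M / (4 e p) and x >= 1 / (4 e). *)
move=> e0 eps0; pose p := (k * k + 2)%N; pose c : R := (16 * e%:R ^+ 2 * p%:R)^-1.
have eR : 0 < e%:R :> R by rewrite ltr0n.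
have pR : 0 < p%:R :> R by rewrite ltr0n /p addn2.
have c0 : 0 < c by rewrite invr_gt0 !mulr_gt0 // exprn_gt0.
near=> M.
have M1 : 1 <= M%:R :> R by near: M; exact: near_ge.
have M0 : 0 < M%:R :> R by apply: lt_le_trans M1.
have Me : (4 * e * p)%:R <= M%:R :> R by near: M; exact: near_ge.
have ML : 2 ^+ (k * k) / c ^+ p / eps <= M%:R by near: M; exact: near_ge.
set d := (M %/ e)%N; pose d' := (d %/ p)%N.
have p0 : (0 < p)%N by rewrite /p addn2.
have {}Me : (4 * e * p <= M)%N by rewrite -(ler_nat R).
have dM : (M <= 2 * e * d)%N.
  have := ltn_ceil M e0; rewrite -/d; have : (4 * e <= M)%N by apply: leq_trans Me; rewrite leq_pmulr.
  nia.
have dp : (2 * p <= d)%N by rewrite leq_divRL //; lia.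
have d'M : (d <= 2 * p * d')%N by have := ltn_ceil d p0; rewrite -/d'; nia.
have dMR : M%:R <= 2 * e%:R * d%:R :> R by rewrite -!natrM ler_nat.
have d'MR : d%:R <= 2 * p%:R * d'%:R :> R by rewrite -!natrM ler_nat.
set x := d%:R / (2 * M%:R).
have x0 : 0 <= x by rewrite divr_ge0 ?mulr_ge0 // ltW.
have xe : (4 * e%:R)^-1 <= x.
  rewrite /x ler_pdivlMr ?mulr_gt0 // mulrC ler_pdivrMr ?mulr_gt0 //; lra.
have cM : c * M%:R <= d'%:R * x.
  apply: (@le_trans _ _ (M%:R / (4 * e%:R * p%:R) * (4 * e%:R)^-1)).
    by rewrite le_eqVlt; apply/orP; left; apply/eqP; rewrite /c; field; rewrite !gt_eqF.
  apply: ler_pM xe; first exact: divr_ge0 (ltW M0) (mulr_ge0 (mulr_ge0 _ (ltW eR)) (ltW pR)).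
    by rewrite invr_ge0 mulr_ge0 // ltW.
  by rewrite ler_pdivrMr ?mulr_gt0 //; nra.
have rho : (c * M%:R) ^+ p <= (1 + x) ^+ d.
  apply: (@le_trans _ _ (((1 + x) ^+ d') ^+ p)).
    rewrite lerXn2r ?nnegrE ?exprn_ge0 ?addr_ge0 ?mulr_ge0 ?(ltW c0) //.
    exact: le_trans cM (bernoulli _ x0).
  by rewrite -exprM ler_weXn2l ?lerDl // leq_divM.
have cMp : 0 < (c * M%:R) ^+ p by rewrite exprn_gt0 // mulr_gt0.
apply: (@le_trans _ _ (M%:R ^+ 3 * ((2 * M%:R) ^+ (k * k) / (c * M%:R) ^+ p))).
  rewrite ler_wpM2l ?exprn_ge0 // ler_pM ?exprn_ge0 ?invr_ge0 ?(le_trans _ rho) ?(ltW cMp) //.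
    by rewrite lerXn2r ?nnegrE ?mulr_ge0 // -natr1; lra.
  by rewrite lef_pV2 ?posrE // (lt_le_trans cMp).
have -> : M%:R ^+ 3 * ((2 * M%:R) ^+ (k * k) / (c * M%:R) ^+ p) =
          2 ^+ (k * k) / c ^+ p * M%:R.
  rewrite !exprMn {2}/p exprD; field.
  by rewrite !expf_neq0 // gt_eqF.
rewrite [M%:R ^+ 2]expr2 mulrA; apply: ler_wpM2r; first exact: ltW.
by rewrite [leRHS]mulrC -ler_pdivrMr.
Unshelve. all: end_near. Qed.

(** The slack d = M %/ e.+1 is a fraction of M small enough that 2 d k + 2 <= eps M, yet linear in M
    as [tail_small] requires. *)
Lemma third_moment_small (R : realType) (k : nat) (eps : R) : (2 < k)%N -> 0 < eps ->
  \forall M \near \oo, forall N (b : 'I_N -> 'I_k) i j,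
    (forall i, (\sum_(x < N) (b x == i) = M)%N) ->
    third_moment R M b i j <= eps * (M%:R * kappa R M b i j + M%:R ^+ 2).
Proof.
move=> k2 eps0; have k_gt1 : (1 < k)%N by lia.
have [e He] : exists e : nat, 4 * k%:R / eps <= e.+1%:R.
  exists (Num.bound (4 * k%:R / eps)); rewrite ltW //.
  apply: lt_trans (archi_boundP _) _; last by rewrite ltr_nat.
  by apply: divr_ge0; [exact: mulr_ge0|exact: ltW].
near=> M => N b i j fb.
have M0 : (0 < M)%N by near: M; exact: nbhs_infty_gt.
have M4 : 4 / eps <= M%:R by near: M; exact: near_ge.
have tail : M%:R ^+ 3 * (M.+1%:R ^+ (k * k) /
    (1 + (M %/ e.+1)%:R / (2 * M%:R)) ^+ (M %/ e.+1)) <= eps * M%:R ^+ 2 :> R.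
  by near: M; exact: tail_small.
apply: le_trans (third_moment_le k2 fb (M %/ e.+1) R i j M0) _.
rewrite mulrDr lerD // mulrA ler_wpM2r //.
  apply: le_trans (second_moment_le R k_gt1 fb i j).
  by rewrite -(EE_cst fb 0); apply: le_EE => // c _; exact: sqr_ge0.
have dM : (M %/ e.+1)%:R * e.+1%:R <= M%:R :> R by rewrite -natrM ler_nat leq_divM.
move: He M4; rewrite !ler_pdivrMr // natrM => He M4.
have d0 : 0 <= (M %/ e.+1)%:R :> R by [].
have := ler_wpM2l d0 He; nra.
Unshelve. all: end_near. Qed.

Section HessianSign.
Context (R : realType) (k : nat) (mu : 'I_k -> nat).
Let n : R := \sum_j (mu j)%:R.
Let U : R := \sum_j (mu j)%:R ^+ 2.
Hypothesis n_gt0 : 0 < n.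

(** Dividing [second_moment_estimate] by [hop0], which is of order M^2, leaves [hop1] times [kappa]
    minus [hop0], whose leading terms give [kappa] ~ (k - 1) M / (k (k - 2)). *)
Lemma kappa_limit (eps : R) : (2 < k)%N -> 0 < eps ->
  \forall M \near \oo, forall N (b : 'I_N -> 'I_k) i j,
    (forall i, (\sum_(x < N) (b x == i) = M)%N) ->
    `|(k%:R - 2) / k%:R * kappa R M b i j - (k%:R - 1) / k%:R ^+ 2 * M%:R|
    <= eps * (kappa R M b i j + M%:R).
Proof.
move=> k2 eps0; have k_gt1 : (1 < k)%N by lia.
have kR : 0 < k%:R :> R by rewrite ltr0n; lia.
have kR2 : 3 <= k%:R :> R by rewrite ler_nat.
(* 288 = 3 * 96: the third moment enters below with coefficient 2 k * 48 and may use a third of the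
   error budget. *)
have eps1 : 0 < eps / (288 * k%:R) by exact: divr_gt0 eps0 (mulr_gt0 (ltr0Sn R 287) kR).
near=> M => N b i j fb.
have M0 : (0 < M)%N by near: M; exact: nbhs_infty_gt.
have M1 : 3 * (1 + 12 * k%:R) / eps <= M%:R by near: M; exact: near_ge.
have T3 : third_moment R M b i j <=
    eps / (288 * k%:R) * (M%:R * kappa R M b i j + M%:R ^+ 2).
  by move: N b i j fb; near: M; exact: third_moment_small.
have M0R : 0 < M%:R :> R by rewrite ltr0n.
have kap0 : 0 <= kappa R M b i j.
  apply: le_trans (second_moment_le R k_gt1 fb i j).
  by rewrite -(EE_cst fb 0); apply: le_EE => // c _; exact: sqr_ge0.
have [i' ii] : exists i', i != i'.
  exact: ord_neq.
have [j' jj] : exists j', j != j'.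
  exact: ord_neq.
have := second_moment_estimate R k_gt1 fb ii jj M0.
move: (kappa R M b i j) (third_moment R M b i j) kap0 T3 => kap t kap0 T3.
have h0 := hop0_ge R M k_gt1; set h := hop0 R k M in h0 *.
have h0p : 0 < h by apply: lt_le_trans h0; rewrite divr_gt0 ?exprn_gt0 ?mulr_gt0.
have -> : h * hop1 R k M * kap - h ^+ 2 = h * (hop1 R k M * kap - h) by ring.
rewrite normrM (gtr0_norm h0p) => H.
have {}H : `|hop1 R k M * kap - h| <= 2 * k%:R * (6 * kap + 48 * t).
  have rhs0 : 0 <= 6 * kap + 48 * t.
    have : 0 <= M%:R ^+ 2 * (6 * kap + 48 * t) by apply: le_trans H; exact: mulr_ge0 (ltW h0p) (normr_ge0 _).
    by rewrite pmulr_rge0 // exprn_gt0.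
  rewrite -(ler_pM2l h0p); apply: le_trans H _.
  have := ler_wpM2r (mulr_ge0 (ltW (mulr_gt0 (ltr0n R 2) kR)) rhs0) h0.
  apply: le_trans; rewrite le_eqVlt; apply/orP; left; apply/eqP; field.
  by rewrite gt_eqF.
have E : hop1 R k M * kap - h =
    M%:R * ((k%:R - 2) / k%:R * kap - (k%:R - 1) / k%:R ^+ 2 * M%:R) + (kap - M%:R / k%:R).
  by rewrite /hop1 /h /hop0; field; rewrite gt_eqF.
rewrite E in H; set X := _ - _ in H *.
rewrite -(ler_pM2l M0R).
have -> : M%:R * `|X| = `|M%:R * X| by rewrite normrM (gtr0_norm M0R).
have b2 : `|kap - M%:R / k%:R| <= kap + M%:R.
  apply: le_trans (ler_normB _ _) _; rewrite (ger0_norm kap0) ger0_norm; last first.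
    exact: divr_ge0 (ltW M0R) (ltW kR).
  rewrite lerD2l.
  by rewrite ler_pdivrMr // ler_peMr //; lra.
have b3 : 96 * k%:R * t <= eps / 3 * (M%:R * (kap + M%:R)).
  have := ler_wpM2l (mulr_ge0 (ler0n R 96) (ltW kR)) T3; move/le_trans; apply.
  by rewrite le_eqVlt; apply/orP; left; apply/eqP; field; rewrite gt_eqF.
have b4 : (1 + 12 * k%:R) * (kap + M%:R) <= eps / 3 * (M%:R * (kap + M%:R)).
  rewrite mulrA; apply: ler_wpM2r; first exact: addr_ge0 kap0 (ltW M0R).
  by move: M1; rewrite ler_pdivrMr //; lra.
have -> : M%:R * X = (M%:R * X + (kap - M%:R / k%:R)) - (kap - M%:R / k%:R) by ring.
apply: le_trans (ler_normB _ _) _.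
have kM : 0 <= k%:R * M%:R :> R by exact: mulr_ge0 (ltW kR) (ltW M0R).
have eM : 0 <= eps * (M%:R * (kap + M%:R)).
  exact: mulr_ge0 (ltW eps0) (mulr_ge0 (ltW M0R) (addr_ge0 kap0 (ltW M0R))).
lra.
Unshelve. all: end_near. Qed.

(** By [kappa_limit], [kappa] / M tends to al / a, so [hess] / M tends to V al / a - w, whose sign
    is opposite to that of [gap]. *)
Lemma hess_sign : (2 < k)%N ->
  \forall M \near \oo, forall N (b : 'I_N -> 'I_k) i j,
    (forall i, (\sum_(x < N) (b x == i) = M)%N) ->
    ((k%:R - 1) * (U - n ^+ 2 / k%:R) < n * (k%:R - 2) -> hess R M b mu i j < 0) /\
    (n * (k%:R - 2) < (k%:R - 1) * (U - n ^+ 2 / k%:R) -> 0 < hess R M b mu i j).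
Proof.
move=> k2; have k_gt1 : (1 < k)%N by lia.
have kR2 : 3 <= k%:R :> R by rewrite ler_nat.
have kR : 0 < k%:R :> R by apply: lt_le_trans kR2.
set a := (k%:R - 2) / k%:R : R; set al := (k%:R - 1) / k%:R ^+ 2 : R.
have a0 : 0 < a by rewrite divr_gt0 //; lra.
have al0 : 0 < al by rewrite divr_gt0 ?exprn_gt0 //; lra.
set V := U - _; set w := n / k%:R.
have w0 : 0 < w by rewrite divr_gt0.
pose gap := w * a - V * al.
have gapE : (k%:R - 1) * V - n * (k%:R - 2) = - (k%:R ^+ 2 * gap).
  by rewrite /gap /w /a /al; field; rewrite gt_eqF.
have k2R : 0 < k%:R ^+ 2 :> R by rewrite exprn_gt0.
have sg1 : ((k%:R - 1) * V < n * (k%:R - 2)) = (0 < gap).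
  by rewrite -subr_lt0 gapE oppr_lt0 pmulr_rgt0.
have sg2 : (n * (k%:R - 2) < (k%:R - 1) * V) = (gap < 0).
  by rewrite -subr_gt0 gapE oppr_gt0 pmulr_rlt0.
rewrite sg1 sg2.
have [g0|gn0] := eqVneq gap 0; first by near=> M => N b i j _; rewrite g0 ltxx.
(* This keeps a - eps positive and the total error eps (|V| + w) below |gap|. *)
pose eps := Num.min (a / 2) (`|gap| / (2 * (`|V| + w + 1))).
have D0 : 0 < 2 * (`|V| + w + 1) by have := normr_ge0 V; lra.
have gapn : 0 < `|gap| by rewrite normr_gt0.
have eps0 : 0 < eps by rewrite lt_min (divr_gt0 a0) // (divr_gt0 gapn D0).
have ea : eps <= a / 2 by rewrite ge_min lexx.
have eg : eps * (2 * (`|V| + w + 1)) <= `|gap|.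
  by rewrite -ler_pdivlMr // ge_min lexx orbT.
near=> M => N b i j fb.
have M0 : (0 < M)%N by near: M; exact: nbhs_infty_gt.
have M0R : 0 < M%:R :> R by rewrite ltr0n.
have H : `|a * kappa R M b i j - al * M%:R| <= eps * (kappa R M b i j + M%:R).
  by move: N b i j fb; near: M; exact: kappa_limit.
have kap0 : 0 <= kappa R M b i j.
  apply: le_trans (second_moment_le R k_gt1 fb i j).
  by rewrite -(EE_cst fb 0); apply: le_EE => // c _; exact: sqr_ge0.
rewrite /hess -/n -/U -/V [n * _ / _]mulrAC -/w.
move: (kappa R M b i j) kap0 H => kap kap0; rewrite ler_norml => /andP[l1 l2].
have wM : 0 < w * M%:R by rewrite mulr_gt0.
have V0 := ler_norm V; have V0' := ler_norm (- V); rewrite normrN in V0'.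
have eV : eps * (`|V| + w) < `|gap|.
  have : 0 < `|gap| by rewrite normr_gt0.
  have : 0 <= eps * (`|V| + w) by rewrite mulr_ge0 ?addr_ge0 // ltW.
  lra.
split=> [gp|gn].
- rewrite (gtr0_norm gp) in eV.
  have [Vneg|Vpos] := ltP V 0; first by have := mulr_ge0_le0 kap0 (ltW Vneg); lra.
  rewrite (ger0_norm Vpos) /gap in eV.
  have ae : 0 < a - eps by lra.
  rewrite subr_lt0 -(ltr_pM2r ae).
  apply: (@le_lt_trans _ _ (V * ((al + eps) * M%:R))).
    by rewrite mulrAC mulrC ler_wpM2l //; lra.
  have : 0 < (w * a - V * al - eps * (V + w)) * M%:R by rewrite mulr_gt0 //; lra.
  lra.
- rewrite (ltr0_norm gn) in eV.
  have Vpos : 0 < V.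
    rewrite ltNge; apply/negP => Vneg; have := mulr_ge0 (ltW w0) (ltW a0).
    by have := mulr_le0_ge0 Vneg (ltW al0); rewrite /gap in gn; lra.
  rewrite (gtr0_norm Vpos) /gap in eV.
  have ae : 0 < a + eps by lra.
  rewrite subr_gt0 -(ltr_pM2r ae).
  apply: (@lt_le_trans _ _ (V * ((al - eps) * M%:R))); last first.
    by rewrite [kap * V]mulrC -mulrA ler_pM2l //; lra.
  have : 0 < (V * al - w * a - eps * (V + w)) * M%:R by rewrite mulr_gt0 //; lra.
  lra.
Unshelve. all: end_near. Qed.


End HessianSign.

(** Here the coefficient of [kappa] is half the squared difference of the two parts. If it vanishes
    only the negative term remains; otherwise [kappa] / M, being unbounded, makes the positive term
    win. *)
Lemma hess_two (R : realType) (mu : 'I_2 -> nat) : (0 < \sum_j (mu j)%:R :> R) ->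
  \forall M \near \oo, forall N (b : 'I_N -> 'I_2) i j,
    (forall i, (\sum_(x < N) (b x == i) = M)%N) ->
    (mu ord0 = mu (lift ord0 ord0) -> hess R M b mu i j < 0) /\
    (mu ord0 <> mu (lift ord0 ord0) -> 0 < hess R M b mu i j).
Proof.
set n := \sum_j _ => n0.
pose x : R := (mu ord0)%:R; pose y : R := (mu (lift ord0 ord0))%:R.
pose V : R := (x - y) ^+ 2 / 2.
have VE : \sum_j (mu j)%:R ^+ 2 - n ^+ 2 / 2 = V.
  by rewrite /n !big_ord_recl !big_ord0 /V /x /y; field.
(* The critical ratio: [hess] is V (kappa - C M). *)
pose C : R := n / (2 * V).
near=> M => N b i j fb.
have M0 : (0 < M)%N by near: M; exact: nbhs_infty_gt.
have M1 : 64 * C + 1 <= M%:R by near: M; exact: near_ge.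
have M0R : 1 <= M%:R :> R by rewrite ler1n.
rewrite /hess -/n VE.
have kap0 : 0 <= kappa R M b i j.
  apply: le_trans (second_moment_le R (isT : (1 < 2)%N) fb i j).
  by rewrite -(EE_cst fb 0); apply: le_EE => // c _; exact: sqr_ge0.
have nM : 0 < n * M%:R / 2 by rewrite divr_gt0 ?mulr_gt0 //; lra.
split=> [e|ne].
  by rewrite /V /x /y e subrr expr0n /= mul0r mulr0; lra.
have V0 : 0 < V.
  rewrite divr_gt0 // lt_neqAle sqr_ge0 eq_sym sqrf_eq0 subr_eq0 eqr_nat.
  by rewrite andbT; apply/eqP.
have C0 : 0 < C by rewrite divr_gt0 // mulr_gt0.
have nE : n = 2 * C * V by rewrite /C; field; rewrite gt_eqF.
have := second_moment_two R i j fb; move: (kappa R M b i j) kap0 => kap kap0.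
rewrite /hop0 nE => H.
suff CM : C * M%:R < kap.
  have : 0 < (kap - C * M%:R) * V by rewrite mulr_gt0 // subr_gt0.
  lra.
(* If kappa <= C M, then [second_moment_two] would give M^4 / 64 <= M^2 (M^2 / 64 - M / 64). *)
rewrite ltNge; apply/negP => kC.
set h := _ * _ in H.
have hE : h = M%:R ^+ 2 / 4 + M%:R / 2 by rewrite /h; field.
have h1 : h <= M%:R ^+ 2 by rewrite hE; nra.
have CM2 : C * M%:R <= M%:R ^+ 2 / 64 - M%:R / 64 by nra.
have l1 : M%:R ^+ 2 / 8 <= h - kap / 4 by rewrite hE; nra.
have l2 : (M%:R ^+ 2 / 8) ^+ 2 <= (h - kap / 4) ^+ 2.
  by rewrite lerXn2r ?nnegrE // ?(le_trans _ l1) // divr_ge0 ?sqr_ge0.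
have M2 : 0 < M%:R ^+ 2 :> R by rewrite exprn_gt0 // ltr0n.
have l3 : h * kap <= M%:R ^+ 2 * (C * M%:R).
  by apply: ler_pM => //; rewrite hE; nra.
have l4 : (M%:R ^+ 2 / 8) ^+ 2 <= M%:R ^+ 2 * (M%:R ^+ 2 / 64 - M%:R / 64) :> R.
  exact: le_trans l2 (le_trans H (le_trans l3 (ler_wpM2l (ltW M2) CM2))).
have : 0 < M%:R ^+ 2 * (M%:R / 64) :> R by rewrite mulr_gt0 // divr_gt0 // ltr0n.
lra.
Unshelve. all: end_near. Qed.

(** * Local extrema and thresholds *)

(** The substitution t = k p - 1 sends U_k to 0, and homogeneity of degree [D] pulls the powers of k
    into the constant. *)
Lemma beta_gen (R : realType) (mu : seq nat) (k M : nat) : (0 < k)%N ->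
  exists2 K : R, 0 < K & forall p : 'rV[R]_k,
    beta mu M p =
    (K * EE M (@blk k M)
       (gen (@blk k M) (fun j => nth 0%N mu j) (fun i => k%:R * p 0 i - 1))) `^ (M%:R^-1).
Proof.
move=> k0; have kR : 0 < k%:R :> R by rewrite ltr0n.
have [K K0 HK] := sum_permanent_lift k M.
pose Z : R := \sum_(c : {ffun 'I_(\sum_(i < k) M) -> 'I_k} | bal M c) (wt M (@blk k M) c)%:R.
have Z0 : 0 < Z by apply: EE_mass_gt0 => i; exact: blk_fiber.
pose D := (\sum_(j < k) M * nth 0 mu j)%N.
pose F : R := #|{ffun 'I_k * 'I_k -> 'S_M}|%:R.
have F0 : 0 < F by rewrite ltr0n; apply/card_gt0P; exists [ffun=> 1%g].
have kD : 0 < k%:R ^+ D :> R by rewrite exprn_gt0.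
exists (K%:R * Z / k%:R ^+ D / F).
  have KR : 0 < K%:R :> R by rewrite ltr0n.
  exact: divr_gt0 (divr_gt0 (mulr_gt0 KR Z0) kD) F0.
move=> p; rewrite /beta /lifted_permanent -/F HK; congr (_ `^ _).
rewrite /EE -/Z.
transitivity (K%:R * (\sum_(c : {ffun 'I_(\sum_(i < k) M) -> 'I_k} | bal M c)
   (wt M (@blk k M) c)%:R *
   gen (@blk k M) (fun j => nth 0%N mu j) (fun i => k%:R * p 0 i - 1) c) / k%:R ^+ D / F);
  last by field; rewrite !gt_eqF.
congr (_ / _); rewrite -mulrA; congr (_ * _); rewrite mulr_suml; apply: eq_bigr => c.
move=> /forallP bc; rewrite -mulrA; congr (_ * _).
have -> : k%:R ^+ D = \prod_(x < \sum_(i < k) M) k%:R ^+ nth 0%N mu (c x) :> R.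
  rewrite prodrXr; congr (_ ^+ _); rewrite (partition_big c predT) //=; apply: eq_bigr => j _.
  transitivity ((\sum_x (c x == j)) * nth 0 mu j)%N; first by rewrite (eqP (bc j)).
  rewrite big_distrl [RHS]big_mkcond; apply: eq_bigr => x _ /=.
  by case: eqP => [->|]; rewrite ?mul1n.
rewrite -prodf_div; apply: eq_bigr => x _.
by rewrite mxE addrC subrK exprMn mulrC mulKf // expf_neq0 // gt_eqF.
Qed.

(** Taking the M-th root is increasing on non-negative reals, so the extremum passes from the
    expectation of [gen], equal to 1 at U_k, to [beta]. *)
Lemma local_extremum (R : realType) (mu : seq nat) (k M : nat) (i j : 'I_k) :
  (1 < k)%N -> (0 < M)%N ->
  (hess R M (@blk k M) (fun j => nth 0%N mu j) i j < 0 ->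
     local_max_on (simplex k) (beta (R := R) (k := k) mu M) (uniform_vec k)) /\
  (0 < hess R M (@blk k M) (fun j => nth 0%N mu j) i j ->
     local_min_on (simplex k) (beta (R := R) (k := k) mu M) (uniform_vec k)).
Proof.
move=> k1 M0; have k0 : (0 < k)%N by lia.
have kR : 0 < k%:R :> R by rewrite ltr0n.
have fb i' : (\sum_(x < \sum_(i < k) M) (blk x == i') = M)%N by exact: blk_fiber.
have [r r0 Hr] := local_sign R k1 fb (fun j => nth 0%N mu j) i j.
have [K K0 HK] := beta_gen R mu M k0.
pose T (p : 'rV[R]_k) (i : 'I_k) := k%:R * p 0 i - 1.
pose G p := EE M (@blk k M) (gen (@blk k M) (fun j => nth 0%N mu j) (T p)).
have bG p : beta mu M p = (K * G p) `^ (M%:R^-1) by exact: HK.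
have unif : simplex k (uniform_vec k : 'rV[R]_k).
  split=> [l|]; first by rewrite mxE invr_ge0 ltW.
  under eq_bigr => l _ do rewrite mxE.
  by rewrite sumr_const card_ord -[LHS]mulr_natl mulfV // gt_eqF.
have GU : G (uniform_vec k) = 1.
  rewrite /G -[RHS](EE_cst fb 1); apply: eq_EE => c _; apply: big1 => x _.
  by rewrite /T mxE mulfV ?gt_eqF // subrr addr0 expr1n.
have G0 p : simplex k p -> 0 <= G p.
  move=> [p0 _]; rewrite /G -(EE_cst fb 0); apply: le_EE => // c _.
  by apply: prodr_ge0 => x _; rewrite /T addrC subrK exprn_ge0 // mulr_ge0 // ltW.
have mono x y : 0 <= x -> x <= y -> (K * x) `^ (M%:R^-1) <= (K * y) `^ (M%:R^-1).
  move=> x0 xy; apply: ge0_ler_powR; rewrite ?invr_ge0 ?nnegrE ?mulr_ge0 ?(ltW K0) //.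
    exact: le_trans xy.
  by rewrite ler_wpM2l // ltW.
have near_r : \forall p \near nbhs (uniform_vec k : 'rV[R]_k), forall l, `|T p l| <= r.
  apply/nbhs_ballP; exists (r / k%:R) => /=; first by rewrite divr_gt0.
  move=> p [_ pr] l; have := pr 0 l; rewrite /ball /= mxE => {}pr.
  rewrite /T (_ : _ - 1 = - (k%:R * (k%:R^-1 - p 0 l))); last by field; rewrite gt_eqF.
  rewrite normrN normrM gtr0_norm // mulrC -ler_pdivlMr //; exact: ltW.
have sumT p : simplex k p -> \sum_l T p l = 0.
  move=> [_ p1]; rewrite sumrB -mulr_sumr p1 sumr_const card_ord; ring.
split=> h; split=> //; apply: (filterS _ near_r) => p pr sp.
  have [Hmax _] := Hr (T p) (sumT p sp) pr.
  by rewrite !bG; apply: mono; rewrite ?G0 // GU; exact: Hmax.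
have [_ Hmin] := Hr (T p) (sumT p sp) pr.
by rewrite !bG; apply: mono; rewrite ?G0 // GU; exact: Hmin.
Qed.

Lemma sum_nth (R : nmodType) (F : nat -> R) (s : seq nat) k : (size s <= k)%N -> F 0%N = 0 ->
  \sum_(j < k) F (nth 0%N s j) = \sum_(x <- s) F x.
Proof.
move=> sk F0; rewrite (big_nth 0%N) big_mkord (big_ord_widen k (fun j => F (nth 0%N s j)) sk).
rewrite [RHS]big_mkcond; apply: eq_bigr => j _; case: ltnP => // js.
by rewrite nth_default.
Qed.

Section Thresholds.
Context (R : realType).

(** Reduces every case to polynomial inequalities for k >= 3, obtained by multiplying those of
    [hess_sign] by k, and to comparing the two parts when k = 2. *)
Lemma threshold_of_sign (mu : seq nat) (Y : \bar R) :
  let n : R := (sum_mu mu)%:R in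
  let U : R := (sumsq_mu mu)%:R in
  (1 < size mu)%N -> (0 < sum_mu mu)%N ->
  (forall k : nat, (2 < k)%N ->
     ((k%:R%:E < Y)%E -> (k%:R - 1) * (k%:R * U - n ^+ 2) < n * k%:R * (k%:R - 2)) /\
     ((Y < k%:R%:E)%E -> n * k%:R * (k%:R - 2) < (k%:R - 1) * (k%:R * U - n ^+ 2))) ->
  (size mu = 2%N ->
     ((2%:E < Y)%E -> nth 0%N mu 0 = nth 0%N mu 1) /\
     ((Y < 2%:E)%E -> nth 0%N mu 0 <> nth 0%N mu 1)) ->
  is_threshold mu Y.
Proof.
move=> n U m1 n0 H3 H2 k mk; have k1 : (1 < k)%N by apply: leq_trans mk.
pose nu (j : 'I_k) := nth 0%N mu j.
have sn : \sum_j (nu j)%:R = n.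
  by rewrite (sum_nth (F := fun x => x%:R) mk) // /n /sum_mu natr_sum.
have sU : \sum_j (nu j)%:R ^+ 2 = U.
  rewrite (sum_nth (F := fun x => x%:R ^+ 2) mk) ?expr0n //.
  by rewrite /U /sumsq_mu natr_sum; apply: eq_bigr => x _; rewrite natrX.
have nR : 0 < n by rewrite ltr0n.
have [k2|k2] := ltnP 2 k.
  have kR : 0 < k%:R :> R by rewrite ltr0n; lia.
  have [lt gt] := H3 k k2.
  have o := Ordinal (ltnW k1).
  near=> M.
  have M0 : (0 < M)%N by near: M; exact: nbhs_infty_gt.
  have HS : forall N (b : 'I_N -> 'I_k) i j,
    (forall i, (\sum_(x < N) (b x == i) = M)%N) ->
    ((k%:R - 1) * (U - n ^+ 2 / k%:R) < n * (k%:R - 2) -> hess R M b nu i j < 0) /\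
    (n * (k%:R - 2) < (k%:R - 1) * (U - n ^+ 2 / k%:R) -> 0 < hess R M b nu i j).
    by rewrite -sn -sU; near: M; apply: (@hess_sign R k nu) => //; rewrite sn.
  have [hneg hpos] := HS _ (@blk k M) o o (@blk_fiber k M).
  have [lmax lmin] := local_extremum R mu o o k1 M0.
  have E1 : k%:R * ((k%:R - 1) * (U - n ^+ 2 / k%:R)) = (k%:R - 1) * (k%:R * U - n ^+ 2).
    by field; rewrite gt_eqF.
  have E2 : k%:R * (n * (k%:R - 2)) = n * k%:R * (k%:R - 2) by ring.
  split=> [/lt|/gt] H; [apply: lmax; apply: hneg|apply: lmin; apply: hpos];
    by rewrite -(ltr_pM2l kR) E1 E2.
(* Here [mu] has exactly two entries, since its size lies between 2 and k. *)
have ek : k = 2%N by lia.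
subst k; have {}mk : size mu = 2%N by lia.
have [e ne] := H2 mk.
near=> M.
have M0 : (0 < M)%N by near: M; exact: nbhs_infty_gt.
have HS : forall N (b : 'I_N -> 'I_2) i j,
    (forall i, (\sum_(x < N) (b x == i) = M)%N) ->
    (nu ord0 = nu (lift ord0 ord0) -> hess R M b nu i j < 0) /\
    (nu ord0 <> nu (lift ord0 ord0) -> 0 < hess R M b nu i j).
  by near: M; apply: (@hess_two R nu); rewrite sn.
have [hneg hpos] := HS _ (@blk 2 M) ord0 ord0 (@blk_fiber 2 M).
have [lmax lmin] := local_extremum R mu ord0 ord0 k1 M0.
by split=> [/e|/ne] H; [apply: lmax; apply: hneg|apply: lmin; apply: hpos].
Unshelve. all: end_near. Qed.

End Thresholds.

(** * Inequalities between the number, the sum and the sum of squares of the parts *)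

Lemma sum_mu_facts (mu : seq nat) : all (ltn 0) mu ->
  [/\ (size mu <= sum_mu mu)%N, (sum_mu mu <= sumsq_mu mu)%N &
      ~~ all (pred1 1%N) mu -> (size mu < sum_mu mu)%N /\ (sum_mu mu < sumsq_mu mu)%N].
Proof.
rewrite /sum_mu /sumsq_mu; elim: mu => [|x s IH]; first by rewrite !big_nil.
rewrite !big_cons /= => /andP[x0 /IH[l1 l2 l3]].
move: (\sum_(i <- s) i)%N (\sum_(i <- s) i ^ 2)%N l1 l2 l3 => n U l1 l2 l3.
split; [lia | nia |]; rewrite negb_and => /orP[x1|/l3[l4 l5]]; first by split; nia.
by split; nia.
Qed.

(** At least two positive parts leave a positive cross term in n^2. *)
Lemma sumsq_lt (mu : seq nat) : all (ltn 0) mu -> (1 < size mu)%N ->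
  (sumsq_mu mu < sum_mu mu ^ 2)%N.
Proof.
have le s : (sumsq_mu s <= sum_mu s ^ 2)%N.
  rewrite /sum_mu /sumsq_mu; elim: s => [|x s IH]; first by rewrite !big_nil.
  by rewrite !big_cons; nia.
case: mu => [|x [|y s]] //= /and3P[x0 y0 s0] _; have := le (y :: s).
have -> : sumsq_mu (x :: y :: s) = (x ^ 2 + sumsq_mu (y :: s))%N by rewrite /sumsq_mu big_cons.
have -> : sum_mu (x :: y :: s) = (x + sum_mu (y :: s))%N by rewrite /sum_mu big_cons.
have : (0 < sum_mu (y :: s))%N by rewrite /sum_mu big_cons; lia.
by move: (sum_mu _) (sumsq_mu _) => S Q; nia.
Qed.

Lemma all_ones_sums (mu : seq nat) : all (pred1 1%N) mu ->
  sum_mu mu = size mu /\ sumsq_mu mu = size mu.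
Proof.
rewrite /sum_mu /sumsq_mu; elim: mu => [|x s IH]; first by rewrite !big_nil.
by rewrite !big_cons /= => /andP[/eqP-> /IH[-> ->]].
Qed.

(** * Explicit thresholds, case by case *)

Section Cases.
Context (R : realType) (mu : seq nat).
Hypotheses (size_mu : (1 < size mu)%N) (mu_gt0 : all (ltn 0) mu).
Let n : R := (sum_mu mu)%:R.
Let U : R := (sumsq_mu mu)%:R.

Let sum_gt0 : (0 < sum_mu mu)%N.
Proof. by have [h _ _] := sum_mu_facts mu_gt0; lia. Qed.

Lemma threshold_all_ones : all (pred1 1%N) mu -> is_threshold mu (+oo%E : \bar R).
Proof.
move=> ones; have [nE UE] := all_ones_sums ones.
apply: threshold_of_sign => //= [k k2|sz].
  split=> // _; rewrite nE UE.
  have kR : 3 <= k%:R :> R by rewrite ler_nat.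
  have mR : 2 <= (size mu)%:R :> R by rewrite ler_nat.
  move: (size mu)%:R k%:R mR kR => p q p2 q3.
  rewrite -subr_gt0 (_ : _ - _ = p * (q * (p - 1) - p)); last by ring.
  rewrite mulr_gt0 //; nra.
split=> // _; case: mu sz ones => [|x [|y []]] //= _ /and3P[/eqP-> /eqP-> _] //.
Qed.

(** Only k = 2 lies below the threshold; for k >= 3 the difference of the two sides factors into
    positive terms. *)
Lemma threshold_two_eq (delta : R) : size mu = 2%N -> nth 0%N mu 0 = nth 0%N mu 1 ->
  (1 < nth 0%N mu 0)%N -> 0 < delta -> delta < 1 -> is_threshold mu (2 + delta)%:E.
Proof.
move=> sz e gt1 d0 d1; apply: threshold_of_sign => // [k k2|_]; last first.
  by split=> // H; exfalso; move: H; rewrite lte_fin; lra.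
have kR : 3 <= k%:R :> R by rewrite ler_nat.
split; first by rewrite lte_fin; lra.
move=> _; case: mu sz e gt1 => [|x [|y []]] //= _ <- x1.
rewrite /sum_mu /sumsq_mu !big_cons !big_nil !addn0 !natrD !natrX.
have : 2 <= x%:R :> R by rewrite ler_nat.
move: x%:R k%:R kR => p q q3 p2; rewrite -subr_gt0.
rewrite (_ : _ - _ = 2 * p * (q - 2) * (p * (q - 1) - q)); last by ring.
rewrite mulr_gt0 // ?mulr_gt0 //; nra.
Qed.

Lemma threshold_two_neq (delta : R) : size mu = 2%N -> nth 0%N mu 0 <> nth 0%N mu 1 ->
  0 < delta -> delta < 1 -> is_threshold mu (1 + delta)%:E.
Proof.
move=> sz ne d0 d1; apply: threshold_of_sign => // [k k2|_]; last first.
  by split=> // H; exfalso; move: H; rewrite lte_fin; lra.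
have kR : 3 <= k%:R :> R by rewrite ler_nat.
split; first by rewrite lte_fin; lra.
move=> _; case: mu mu_gt0 sz ne => [|x [|y []]] //= /and3P[x0 y0 _] _ ne.
rewrite /sum_mu /sumsq_mu !big_cons !big_nil !addn0 !natrD !natrX.
have n3 : 3 <= x%:R + y%:R :> R by rewrite -natrD ler_nat; lia.
have e1 : 1 <= (x%:R - y%:R) ^+ 2 :> R.
  have [xy|yx] := ltnP x y.
    have : x%:R + 1 <= y%:R :> R by rewrite natr1 ler_nat.
    nra.
  have : y%:R + 1 <= x%:R :> R by rewrite natr1 ler_nat; lia.
  nra.
move: x%:R y%:R k%:R kR n3 e1 => p r q q3 n3 e1; rewrite -subr_gt0.
(* The first summand is what equal parts of the same total would give, and is non-negative as n >=
   3; the second is strictly positive because the parts differ. *)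
rewrite (_ : _ - _ = ((q - 2) * (p + r) * ((q - 1) * (p + r) - 2 * q)
   + q * (q - 1) * (p - r) ^+ 2) / 2); last by field.
have h1 : 0 <= (q - 1) * (p + r) - 2 * q by nra.
have h2 : 0 < q * (q - 1) by nra.
rewrite divr_gt0 // ltr_wpDl // ?mulr_ge0 //; try lra.
by rewrite mulr_gt0 //; lra.
Qed.

Section Mixed.
Hypothesis size_mu3 : (2 < size mu)%N.
Hypothesis not_ones : ~~ all (pred1 1%N) mu.

(** Denominator and numerator of Upsilon = g / a. *)
Let a : R := U - n.
Let g : R := n ^+ 2 - n.

Let n4 : 4 <= n.
Proof.
have [_ _ /(_ not_ones)[h _]] := sum_mu_facts mu_gt0.
by rewrite ler_nat; lia.
Qed.

Let a_gt0 : 0 < a.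
Proof.
have [_ _ /(_ not_ones)[_ h]] := sum_mu_facts mu_gt0.
by rewrite subr_gt0 ltr_nat.
Qed.

Let a_lt_g : a < g.
Proof.
have := sumsq_lt mu_gt0 size_mu.
by rewrite -(ltr_nat R) natrX /a /g -/n -/U; lra.
Qed.

Lemma UpsilonE : Upsilon mu = (g / a)%:E :> \bar R.
Proof. by rewrite /Upsilon (negPf not_ones). Qed.

(* The sign of the Hessian is that of the quadratic [a (k - 1) (k - g / a) + n]. *)
Lemma sign_quadratic (q : R) :
  (q - 1) * (q * U - n ^+ 2) - n * q * (q - 2) = (q - 1) * (a * q - g) + n.
Proof. by rewrite /a /g; ring. Qed.

Let sqrt_n : 2 <= Num.sqrt n /\ Num.sqrt n ^+ 2 = n.
Proof.
have hn := n4; have ha := a_gt0; have hg := a_lt_g.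
have h : Num.sqrt n ^+ 2 = n by rewrite sqr_sqrtr //; lra.
split=> //; rewrite -(@ler_pXn2r _ 2) ?nnegrE ?sqrtr_ge0 //; lra.
Qed.

(** As n >= 4, the bound on Upsilon is at most 3, so every admissible k lies above it and makes the
    quadratic at least n. *)
Lemma threshold_small :
  g / a < (Num.sqrt n + 1) / (Num.sqrt n - 1) -> is_threshold mu (g / a)%:E.
Proof.
have hn := n4; have ha := a_gt0; have hg := a_lt_g.
have [w2 wE] := sqrt_n; move=> H.
have g3 : g / a < 3.
  by apply: lt_le_trans H _; rewrite ler_pdivrMr; lra.
apply: threshold_of_sign => // [k k2|sz]; last by exfalso; move: size_mu3; rewrite sz.
have kR : 3 <= k%:R :> R by rewrite ler_nat.
split; first by rewrite lte_fin; lra.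
move=> _; rewrite -subr_gt0 -/n -/U sign_quadratic.
rewrite ltr_pdivrMr // in g3.
have : 0 <= (k%:R - 1) * (a * k%:R - g) by apply: mulr_ge0; nra.
lra.
Qed.

Section Large.
Hypothesis large : ~~ (g / a < (Num.sqrt n + 1) / (Num.sqrt n - 1)).

(** The discriminant of [sign_quadratic] seen as a q^2 - (a + g) q + n^2. *)
Let D : R := (n ^+ 2 + 2 * n - U) ^+ 2 - 4 * n ^+ 3.
Let s : R := Num.sqrt D.

(** With w the square root of n, g = w^2 (w - 1) (w + 1), so the hypothesis says a <= w^2 (w - 1)^2,
    that is 2 w^3 <= n^2 + 2 n - U. *)
Let D_ge0 : 0 <= D.
Proof.
have hn := n4; have ha := a_gt0; have hg := a_lt_g.
have [] := sqrt_n; move: large; rewrite -leNgt /D /g.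
have -> : U = a + n by rewrite /a; ring.
move: (Num.sqrt n) => w le w2 wE; rewrite -wE in le *.
have w1 : 0 < w - 1 by lra.
move: le; rewrite ler_pdivlMr // mulrAC ler_pdivrMr // => le.
have le2 : a <= w ^+ 2 * (w - 1) ^+ 2.
  have w3 : 0 < w + 1 by lra.
  rewrite -(ler_pM2l w3); apply: le_trans le _.
  by rewrite le_eqVlt; apply/orP; left; apply/eqP; ring.
rewrite subr_ge0 (_ : 4 * _ = (2 * w ^+ 3) ^+ 2); last by ring.
have w30 : 0 <= 2 * w ^+ 3 by rewrite mulr_ge0 // exprn_ge0 //; lra.
have le3 : 2 * w ^+ 3 <= (w ^+ 2) ^+ 2 + 2 * w ^+ 2 - (a + w ^+ 2).
  rewrite -subr_ge0 (_ : _ - _ = w ^+ 2 * (w - 1) ^+ 2 - a); last by ring.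
  by rewrite subr_ge0.
by rewrite lerXn2r ?nnegrE // (le_trans w30).
Qed.

Let s_ge0 : 0 <= s. Proof. exact: sqrtr_ge0. Qed.

Let sE : s ^+ 2 = (a + g) ^+ 2 - 4 * n ^+ 2 * a.
Proof. by rewrite sqr_sqrtr // /D /a /g; ring. Qed.

Lemma UpsilonB_sqrtE : UpsilonB_sqrt mu = (a + g + s) / (2 * a).
Proof.
rewrite /UpsilonB_sqrt -/n -/U -/D -/s -/a; congr (_ / _).
by rewrite /a /g; ring.
Qed.

Let s_lower : g - 3 * a <= s.
Proof.
have hn := n4; have ha := a_gt0.
have [neg|pos] := leP (g - 3 * a) 0; first exact: le_trans s_ge0.
rewrite -(@ler_pXn2r _ 2) ?nnegrE ?(ltW pos) // sE -subr_ge0.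
(* The last factor is non-negative: 3 a < g makes 2 g - 2 a exceed 4 g / 3, which is at least n^2
   because n >= 4. *)
rewrite (_ : _ - _ = 4 * a * (2 * g - 2 * a - n ^+ 2)); last by ring.
rewrite mulr_ge0 // ?mulr_ge0 // ?(ltW a_gt0) //.
have : 0 <= n * (n - 4) by rewrite mulr_ge0; lra.
by rewrite /g in pos *; lra.
Qed.

Let s_upper : s < g - a.
Proof.
have hn := n4; have ha := a_gt0; have hg := a_lt_g.
have ga : 0 < g - a by rewrite subr_gt0.
rewrite -(@ltr_pXn2r _ 2) ?nnegrE ?(ltW ga) // sE -subr_gt0.
rewrite (_ : _ - _ = 4 * a * n); last by rewrite /g; ring.
by rewrite !mulr_gt0 //; lra.
Qed.

Lemma Upsilon_pred_le : g / a - 1 <= UpsilonB_sqrt mu.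
Proof.
have hn := n4; have ha := a_gt0; have hg := a_lt_g.
rewrite UpsilonB_sqrtE ler_pdivlMr; last by lra.
rewrite (_ : (g / a - 1) * (2 * a) = 2 * g - 2 * a); last by field; rewrite gt_eqF.
by have := s_lower; lra.
Qed.

Lemma UpsilonB_lt : UpsilonB_sqrt mu < g / a.
Proof.
have hn := n4; have ha := a_gt0; have hg := a_lt_g.
rewrite UpsilonB_sqrtE ltr_pdivrMr; last by lra.
rewrite (_ : g / a * (2 * a) = 2 * g); last by field; rewrite gt_eqF.
by have := s_upper; lra.
Qed.

(** The quadratic factors through its two roots; every k >= 3 exceeds the smaller one, so the
    position relative to the larger root decides the sign. *)
Lemma threshold_sqrt : is_threshold mu (UpsilonB_sqrt mu : R)%:E.
Proof.
have hn := n4; have ha := a_gt0; have hg := a_lt_g.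
apply: threshold_of_sign => // [k k2|sz]; last by exfalso; move: size_mu3; rewrite sz.
have kR : 3 <= k%:R :> R by rewrite ler_nat.
have a2 : 0 < 2 * a by lra.
rewrite !lte_fin UpsilonB_sqrtE ltr_pdivlMr // ltr_pdivrMr //.
have neg (x y : R) : (x < y) = (x - y < 0) by rewrite subr_lt0.
have pos (x y : R) : (x < y) = (0 < y - x) by rewrite subr_gt0.
rewrite [X in (_ -> is_true X) /\ _]neg [X in _ /\ (_ -> is_true X)]pos -/n -/U !sign_quadratic.
move: k%:R kR => q q3.
have fE : 4 * a * ((q - 1) * (a * q - g) + n) = (q * (2 * a) - (a + g + s)) * (q * (2 * a) - (a + g - s)).
  transitivity (4 * a ^+ 2 * q ^+ 2 - 4 * a * q * (a + g) + (a + g) ^+ 2 - s ^+ 2); last by ring.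
  by rewrite sE /g; ring.
have a4 : 0 < 4 * a by lra.
(* By [s_lower], a + g - s is at most 4 a, while q >= 3 gives 2 a q >= 6 a. *)
have r2 : 0 < q * (2 * a) - (a + g - s).
  have : 6 * a <= q * (2 * a) by have := ler_wpM2r (ltW a2) q3; lra.
  by have := s_lower; lra.
rewrite -(pmulr_rlt0 _ a4) -(pmulr_rgt0 _ a4) fE pmulr_llt0 // pmulr_lgt0 //.
by rewrite subr_lt0 subr_gt0.
Qed.

End Large.
End Mixed.
End Cases.

Theorem theorem2 (R : realType) (m : nat) (mu : m.-tuple nat)
    (hm : (2 <= m)%N) (hmu : forall i : 'I_m, (0 < tnth mu i)%N) :
  (exists Y : \bar R, is_threshold mu Y) /\
  (m = 2%N ->
     let mu1 := nth 0%N mu 0 in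
     let mu2 := nth 0%N mu 1 in
     forall delta : R, 0 < delta -> delta < 1 ->
       (mu1 = 1%N /\ mu2 = 1%N -> is_threshold mu (+oo : \bar R)%E) /\
       (mu1 = mu2 /\ (1 < mu1)%N -> is_threshold mu (2 + delta)%:E) /\
       (mu1 <> mu2 -> is_threshold mu (1 + delta)%:E)) /\
  ((3 <= m)%N ->
     let n : R := (sum_mu mu)%:R in
     let bound : \bar R := ((Num.sqrt n + 1) / (Num.sqrt n - 1))%:E in
     let Ups : \bar R := Upsilon mu in
     (Ups = +oo%E -> is_threshold mu (+oo : \bar R)%E) /\
     ((Ups < bound)%E -> is_threshold mu Ups) /\
     (Ups <> +oo%E -> ~ (Ups < bound)%E ->
        is_threshold mu (UpsilonB_sqrt mu : R)%:E /\
        (Ups - 1 <= (UpsilonB_sqrt mu)%:E)%E /\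
        ((UpsilonB_sqrt mu)%:E < Ups)%E)).
Proof.
have sz : size mu = m by rewrite size_tuple.
have sz2 : (1 < size mu)%N by rewrite sz.
have pos : all (ltn 0) mu by apply/all_tnthP.
have two : m = 2%N -> forall delta : R, 0 < delta -> delta < 1 ->
    (nth 0%N mu 0 = 1%N /\ nth 0%N mu 1 = 1%N -> is_threshold mu (+oo%E : \bar R)) /\
    (nth 0%N mu 0 = nth 0%N mu 1 /\ (1 < nth 0%N mu 0)%N ->
       is_threshold mu (2 + delta)%:E) /\
    (nth 0%N mu 0 <> nth 0%N mu 1 -> is_threshold mu (1 + delta)%:E).
  move=> m2 delta d0 d1; have {}sz : size mu = 2%N by rewrite sz.
  split=> [[e1 e2]|].
    apply: threshold_all_ones => //.
    by case: (tval mu) sz e1 e2 => [|x [|y []]] //= _ -> ->.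
  split=> [[e g1]|ne]; first exact: threshold_two_eq.
  exact: threshold_two_neq.
have three : (3 <= m)%N ->
     let n : R := (sum_mu mu)%:R in
     let bound : \bar R := ((Num.sqrt n + 1) / (Num.sqrt n - 1))%:E in
     let Ups : \bar R := Upsilon mu in
     (Ups = +oo%E -> is_threshold mu (+oo%E : \bar R)) /\
     ((Ups < bound)%E -> is_threshold mu Ups) /\
     (Ups <> +oo%E -> ~ (Ups < bound)%E ->
        is_threshold mu (UpsilonB_sqrt mu : R)%:E /\
        (Ups - 1 <= (UpsilonB_sqrt mu)%:E)%E /\
        ((UpsilonB_sqrt mu)%:E < Ups)%E).
  move=> m3 n bound Ups; have sz3 : (2 < size mu)%N by rewrite sz.
  have [ones|nones] := boolP (all (pred1 1%N) mu).
    have -> : Ups = +oo%E by rewrite /Ups /Upsilon ones.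
    by split=> [_|]; [exact: threshold_all_ones|split].
  rewrite /Ups UpsilonE // lte_fin; split=> //; split=> [|_ /negP large].
    exact: threshold_small.
  split; first exact: threshold_sqrt.
  by rewrite lte_fin -EFinB lee_fin Upsilon_pred_le // UpsilonB_lt.
split=> //; have [m3|m3] := ltnP 2 m; last first.
  have m2 : m = 2%N by lia.
  (* Existence for m = 2 takes delta = 1 / 2. *)
  have [e1 [e2 e3]] := two m2 (1 / 2) ltac:(lra) ltac:(lra).
  have [e|/eqP ne] := eqVneq (nth 0%N mu 0) (nth 0%N mu 1); last by eexists; exact: e3.
  have [g1|l1] := ltnP 1 (nth 0%N mu 0); first by eexists; exact: e2.
  have p0 : (0 < nth 0%N mu 0)%N by apply: (elimT (all_nthP 0%N) pos); lia.
  by eexists; apply: e1; split; lia.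
have [e1 [e2 e3]] := three m3.
have [/e1 h|/eqP n1] := eqVneq (Upsilon mu : \bar R) +oo%E; first by eexists; exact: h.
have [/e2 h|/negP n2] := boolP (Upsilon mu < ((Num.sqrt ((sum_mu mu)%:R : R) + 1) /
  (Num.sqrt ((sum_mu mu)%:R : R) - 1))%:E)%E; first by eexists; exact: h.
by have [h _] := e3 n1 n2; eexists; exact: h.
Qed.
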